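(* Let $\mathcal Z_\nu$ be the Zorich map described in the context with $\lambda>L^5$ and $\nu>\sqrt{2L/\lambda}$. Then the escaping set $I(\mathcal Z_\nu)=\{x\in\mathbb R^3:|\mathcal Z_\nu^n(x)|\to\infty\text{ as }n\to\infty\}$ is a connected subset of $\mathbb R^3$.
   Context: Zorich maps. Let $Q=\{(x_1,x_2)\in\mathbb R^2:|x_1|\le1,|x_2|\le1\}$. Let $L\ge1$ and let $\mathfrak h=(\mathfrak h_1,\mathfrak h_2,\mathfrak h_3)$ be a sense-preserving $L$-bi-Lipschitz map (i.e. $|a-b|/L\le|\mathfrak h(a)-\mathfrak h(b)|\le L|a-b|$) of $Q$ onto the closed upper unit hemisphere $\{x\in\mathbb R^3:|x|=1,x_3\ge0\}$, with $\partial Q$ mapped onto the equator. Assume $\mathfrak h_1(t,t)=\mathfrak h_2(t,t)$ and $\mathfrak h_1(t,-t)=-\mathfrak h_2(t,-t)$ for $t\in[-1,1]$ (so $\mathfrak h(0,0)=(0,0,1)$). Let $\lambda\ge1$ and $h(x_1,x_2)=\lambda\mathfrak h(x_1/\lambda,x_2/\lambda)$ on $\lambda Q=[-\lambda,\lambda]^2$. For $\nu>0$ set $\mathcal Z_\nu(x_1,x_2,x_3)=\nu e^{x_3}h(x_1,x_2)$ on $\lambda Q\times\mathbb R$ (which is mapped onto $\{x_3\ge0\}$), and extend $\mathcal Z_\nu$ to $\mathbb R^3$ by repeated reflection: in the domain across the faces $x_1=(2k+1)\lambda$, $x_2=(2k+1)\lambda$ ($k\in\mathbb Z$) of the beams,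 and in the range across the plane $x_3=0$. The resulting $\mathcal Z_\nu:\mathbb R^3\to\mathbb R^3$ is quasiregular with an essential singularity at infinity. *)

(* Defs.v *)
(* R : realType, points of R^3 as triples R * R * R
   (product topology = standard topology of R^3). *)
From HB Require Import structures.
From mathcomp Require Import all_boot all_order all_algebra.
From mathcomp Require Import all_classical all_reals all_analysis.
Set Implicit Arguments. Unset Strict Implicit. Unset Printing Implicit Defensive.
Import Order.TTheory GRing.Theory Num.Theory.
Import numFieldNormedType.Exports.
Local Open Scope classical_set_scope.
Local Open Scope ring_scope.

Section Zorich.
Variable R : realType.

Definition R2 := (R * R)%type.
Definition R3 := (R * R * R)%type.

Definition c1 (x : R3) : R := x.1.1.
Definition c2 (x : R3) : R := x.1.2.
Definition c3 (x : R3) : R := x.2.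

Definition norm2 (a : R2) : R := Num.sqrt (a.1 ^+ 2 + a.2 ^+ 2).
Definition norm3 (x : R3) : R := Num.sqrt (c1 x ^+ 2 + c2 x ^+ 2 + c3 x ^+ 2).
Definition dist2 (a b : R2) : R := norm2 (a.1 - b.1, a.2 - b.2).
Definition dist3 (x y : R3) : R := norm3 (c1 x - c1 y, c2 x - c2 y, c3 x - c3 y).

Definition Qsq : set R2 := [set a | `|a.1| <= 1 /\ `|a.2| <= 1].
Definition bdQ : set R2 := [set a | Qsq a /\ (`|a.1| = 1 \/ `|a.2| = 1)].

Definition hemisphere : set R3 := [set x | norm3 x = 1 /\ 0 <= c3 x].
Definition equator : set R3 := [set x | norm3 x = 1 /\ c3 x = 0].

Definition bilipschitz_on_Q (L : R) (hh : R2 -> R3) : Prop :=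
  forall a b, Qsq a -> Qsq b ->
    dist2 a b / L <= dist3 (hh a) (hh b) /\ dist3 (hh a) (hh b) <= L * dist2 a b.

Definition orient (a b c : R2) : R :=
  (b.1 - a.1) * (c.2 - a.2) - (b.2 - a.2) * (c.1 - a.1).

Definition proj12 (x : R3) : R2 := (c1 x, c2 x).

(* sense-preserving (w.r.t. the orientation of the hemisphere given by the
   outward normal, equivalently by vertical projection to the unit disk):
   the boundary homeomorphism  proj12 o hh : dQ -> unit circle  preserves the
   cyclic (counterclockwise) order of boundary points. *)
Definition sense_preserving_Q (hh : R2 -> R3) : Prop :=
  forall a b c, bdQ a -> bdQ b -> bdQ c -> 0 < orient a b c ->
    0 < orient (proj12 (hh a)) (proj12 (hh b)) (proj12 (hh c)).

(* folding of R onto [-lam, lam] by repeated reflection across the points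
   (2k+1) lam; [fold_index] is the index k of the cell [(2k-1)lam,(2k+1)lam] *)
Definition fold_index (lam x : R) : int := Num.floor ((x + lam) / (2 * lam)).
Definition fold (lam x : R) : R :=
  (-1) ^+ absz (fold_index lam x) * (x - 2 * lam * (fold_index lam x)%:~R).

Definition zorich (hh : R2 -> R3) (lam nu : R) (x : R3) : R3 :=
  let k1 := fold_index lam (c1 x) in
  let k2 := fold_index lam (c2 x) in
  let y := hh (fold lam (c1 x) / lam, fold lam (c2 x) / lam) in
  let s := nu * expR (c3 x) * lam in
  (s * c1 y, s * c2 y, s * ((-1) ^+ (absz k1 + absz k2) * c3 y)).

Definition escaping_set (f : R3 -> R3) : set R3 :=
  [set x | (fun n : nat => norm3 (iter n f x)) @ \oo --> +oo].

End Zorich.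
Arguments Qsq R : clear implicits.
Arguments bdQ R : clear implicits.
Arguments hemisphere R : clear implicits.
Arguments equator R : clear implicits.

(* Main.v *)
(* Write Z for the map, c = nu * lam > 1, and call the lines
   (2 lam k1, 2 lam k2) x R axes; Z maps every axis into the x3-axis T, which
   escapes, so all axes escape. Let P be a locally constant property on the
   escaping set I which holds on T; we show that P holds on all preimages of T,
   and hence on I because these are dense in I (orbits in I have
   x3 -> +oo, where the inverse branches contract strongly).

   The point is that 0, the asymptotic value of Z, lies in I. For large n the
   pull-back of a neighbouring axis under the branch of Z^-n along T passes
   close to T from above 0 to below 0 on a prescribed side, since the diagonal
   planes are preserved; its preimage under Z is then a connected subset of I
   accumulating, as n grows, on two prescribed neighbouring axes. So P cannot
   separate two axes, and this argument takes place deep in {x3 < -M}, where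
   all inverse branches of a given iterate are defined. Thus P extends from
   Z^-n(T) to Z^-(n+1)(T): lift an axis from a point of Z^-(n+1)(T) down to
   {x3 < -M}, then change the axis there to T. *)
Require Import Defs.
From HB Require Import structures.
From mathcomp Require Import all_boot all_order all_algebra.
From mathcomp Require Import all_classical all_reals all_analysis.
From mathcomp Require Import ring lra.
Import Order.TTheory GRing.Theory Num.Theory.
Import numFieldNormedType.Exports.
Local Open Scope classical_set_scope.
Local Open Scope ring_scope.

(** [Z] omits 0 and is branched along the edges of the beams, so a curve cannot in general be lifted
    by continuing a branch of the inverse. Two substitutes are used. Far from the plane x3 = 0,
    genuine inverse branches of each iterate exist. Elsewhere axes are lifted by a quantitative
    openness of [Z], whose constants deteriorate only when an orbit comes near 0; as the forward
    orbit of 0 stays on T, this cannot happen to points that are mapped onto another axis.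
    Connectedness is phrased through properties P that are locally constant on part of the escaping
    set, because such a P can be composed with an inverse branch that exists only in {x3 < -M}.
    Estimates for the inverse are relative: a displacement of y counts as |y' - y| / |y|, so
    branches contract as soon as |y| is large. *)

Section Norms.
Variable R : realType.
Implicit Types (x y : R3 R) (a b : R2 R).

(** * The sup norm of the product type against the Euclidean [norm3] *)

Lemma subrBB x y (z : R3 R) : (z - y) - (z - x) = x - y.
Proof. by rewrite opprB addrC subrKA. Qed.

Lemma c1_le_norm x : `|c1 x| <= `|x|.
Proof. by rewrite /Num.norm /= !le_max lexx. Qed.

Lemma c2_le_norm x : `|c2 x| <= `|x|.
Proof. by rewrite [X in _ <= X]/Num.norm /= !le_max lexx orbT. Qed.

Lemma c3_le_norm x : `|c3 x| <= `|x|.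
Proof. by rewrite [X in _ <= X]/Num.norm /= !le_max lexx orbT. Qed.

Lemma norm_ler x (e : R) :
  `|c1 x| <= e -> `|c2 x| <= e -> `|c3 x| <= e -> `|x| <= e.
Proof. by move=> *; rewrite [X in X <= _]/Num.norm /= !ge_max; apply/andP; split=> //; apply/andP. Qed.

Lemma norm_ltr x (e : R) :
  `|c1 x| < e -> `|c2 x| < e -> `|c3 x| < e -> `|x| < e.
Proof. by move=> *; rewrite [X in X < _]/Num.norm /= !gt_max; apply/andP; split=> //; apply/andP. Qed.

Lemma norm3_ge0 x : 0 <= norm3 x.
Proof. exact: sqrtr_ge0. Qed.

Lemma sqr_norm3 x : norm3 x ^+ 2 = c1 x ^+ 2 + c2 x ^+ 2 + c3 x ^+ 2.
Proof. by rewrite /norm3 sqr_sqrtr// !addr_ge0 ?sqr_ge0. Qed.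

Lemma norm3_eq x (e : R) : 0 <= e ->
  c1 x ^+ 2 + c2 x ^+ 2 + c3 x ^+ 2 = e ^+ 2 -> norm3 x = e.
Proof. by move=> e0 xe; rewrite /norm3 xe sqrtr_sqr ger0_norm. Qed.

Lemma norm3_le x (e : R) : 0 <= e ->
  c1 x ^+ 2 + c2 x ^+ 2 + c3 x ^+ 2 <= e ^+ 2 -> norm3 x <= e.
Proof.
move=> e0 xe; rewrite -(ler_pXn2r (n := 2))// ?nnegrE ?norm3_ge0//.
by rewrite sqr_norm3.
Qed.

Lemma norm_le_norm3 x : `|x| <= norm3 x.
Proof.
have H (u : R) : u ^+ 2 <= norm3 x ^+ 2 -> `|u| <= norm3 x.
  by move=> ux; rewrite -(ler_pXn2r (n := 2))// ?nnegrE ?norm3_ge0// real_normK ?num_real.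
apply: norm_ler; apply: H; rewrite sqr_norm3.
- by rewrite -addrA lerDl addr_ge0 ?sqr_ge0.
- by rewrite addrAC lerDr addr_ge0 ?sqr_ge0.
- by rewrite lerDr addr_ge0 ?sqr_ge0.
Qed.

Lemma sqr_le_norm (u e : R) : `|u| <= e -> u ^+ 2 <= e ^+ 2.
Proof. by move=> ue; rewrite -[u ^+ 2]real_normK ?num_real// ler_pXn2r ?nnegrE// (le_trans _ ue). Qed.

(** The factor 2 stands for the sharp constant sqrt 3. *)
Lemma norm3_le_norm x : norm3 x <= 2 * `|x|.
Proof.
apply: norm3_le; first by rewrite mulr_ge0.
have := sqr_le_norm _ _ (c1_le_norm x); have := sqr_le_norm _ _ (c2_le_norm x).
have := sqr_le_norm _ _ (c3_le_norm x); have := sqr_ge0 `|x|.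
rewrite exprMn; lra.
Qed.

Lemma norm3D x y : norm3 (x + y) <= norm3 x + norm3 y.
Proof.
apply: norm3_le; first by rewrite addr_ge0 ?norm3_ge0.
rewrite [leRHS]sqrrD !sqr_norm3 /c1 /c2 /c3 /=.
suff : x.1.1 * y.1.1 + x.1.2 * y.1.2 + x.2 * y.2 <= norm3 x * norm3 y by rewrite -mulr_natl; nra.
apply: le_trans (ler_norm _) _.
rewrite -(ler_pXn2r (n := 2))// ?nnegrE ?mulr_ge0 ?norm3_ge0// real_normK ?num_real//.
rewrite exprMn !sqr_norm3 /c1 /c2 /c3 -subr_ge0.
set a := x.1.1; set b := x.1.2; set c := x.2; set d := y.1.1; set e := y.1.2; set f := y.2.
(* Lagrange's identity, which gives the Cauchy-Schwarz inequality. *)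
have -> : (a ^+ 2 + b ^+ 2 + c ^+ 2) * (d ^+ 2 + e ^+ 2 + f ^+ 2) - (a * d + b * e + c * f) ^+ 2
  = (a * e - b * d) ^+ 2 + (a * f - c * d) ^+ 2 + (b * f - c * e) ^+ 2 by ring.
by rewrite !addr_ge0 ?sqr_ge0.
Qed.

Lemma norm3N x : norm3 (- x) = norm3 x.
Proof. by rewrite /norm3 /c1 /c2 /c3 /= !sqrrN. Qed.

Lemma norm3_lip x y : `|norm3 x - norm3 y| <= 2 * `|x - y|.
Proof.
apply: le_trans (norm3_le_norm _); rewrite ler_norml.
have := norm3D (x - y) y; have := norm3D (y - x) x; rewrite !subrK -opprB norm3N => h1 h2.
by apply/andP; split; lra.
Qed.

Lemma dist3E x y : dist3 x y = norm3 (x - y).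
Proof. by []. Qed.

Lemma norm3_gt0 x : (0 < norm3 x) = (x != 0).
Proof.
apply/idP/idP => [|x0]; first by apply: contraTneq => ->; rewrite /norm3 /c1/c2/c3/= !expr0n/= !addr0 sqrtr0 ltxx.
by apply: lt_le_trans (norm_le_norm3 x); rewrite normr_gt0.
Qed.

Lemma abs_le_dist2 a b : `|a.1 - b.1| <= dist2 a b /\ `|a.2 - b.2| <= dist2 a b.
Proof.
by rewrite /dist2 /norm2/= -!sqrtr_sqr !ler_wsqrtr ?lerDl ?lerDr ?sqr_ge0.
Qed.

Lemma dist2_le a b : dist2 a b <= `|a.1 - b.1| + `|a.2 - b.2|.
Proof.
rewrite /dist2 /norm2 /= -[leRHS]ger0_norm ?addr_ge0// -sqrtr_sqr ler_wsqrtr//.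
have n1 := normr_ge0 (a.1 - b.1); have n2 := normr_ge0 (a.2 - b.2).
rewrite [leRHS]sqrrD !real_normK ?num_real//.
by rewrite addrAC lerDl -mulr_natl !mulr_ge0.
Qed.

Lemma IVT_eps (f : R -> R) (a b v : R) : a <= b ->
  (forall t e, a <= t <= b -> 0 < e -> exists2 d, 0 < d &
     forall t', a <= t' <= b -> `|t' - t| < d -> `|f t' - f t| < e) ->
  (f a <= v <= f b) \/ (f b <= v <= f a) ->
  exists2 t, a <= t <= b & f t = v.
Proof.
move=> ab cf fv.
have wf : {within `[a, b], continuous f}.
  apply/subspace_continuousP => t /=; rewrite in_itv/= => tab.
  apply/cvgrPdist_lt => e e0; have [d d0 fd] := cf t e tab e0.
  rewrite !near_withinE; apply/nbhs_ballP; exists d => //= t' tt' /=; rewrite in_itv/= => t'ab.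
  by rewrite distrC; apply: fd => //; rewrite distrC.
have [t tab ft] : exists2 t, t \in `[a, b] & f t = v.
  apply: IVT => //; rewrite ge_min le_max.
  by case: fv => /andP[-> ->]; rewrite ?orbT.
by exists t.
Qed.

End Norms.

(** * The map [hh] between the square and the hemisphere, and its behaviour on the diagonals *)

Section ZorichEscaping.
Variables (R : realType) (hh : R2 R -> R3 R) (L lam nu c : R).
Hypotheses (L_ge1 : 1 <= L) (hh_bilip : bilipschitz_on_Q L hh)
  (hh_Q : hh @` Qsq R = hemisphere R) (hh_bdQ : hh @` bdQ R = equator R)
  (hh_diag : forall t : R, -1 <= t <= 1 -> c1 (hh (t, t)) = c2 (hh (t, t)))
  (hh_antidiag : forall t : R, -1 <= t <= 1 ->
     c1 (hh (t, - t)) = - c2 (hh (t, - t)))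
  (lam_ge1 : 1 <= lam) (c_gt1 : 1 < c) (cE : c = nu * lam).

Lemma L_gt0 : 0 < L.
Proof. exact: lt_le_trans ltr01 L_ge1. Qed.

Lemma lam_gt0 : 0 < lam.
Proof. exact: lt_le_trans ltr01 lam_ge1. Qed.

Lemma R3_eq (x y : R3 R) :
  c1 x = c1 y -> c2 x = c2 y -> c3 x = c3 y -> x = y.
Proof. by case: x => [[? ?] ?]; case: y => [[? ?] ?]; rewrite /c1 /c2 /c3 /= => -> -> ->. Qed.

Lemma hh_hemisphere (a : R2 R) : Qsq R a -> hemisphere R (hh a).
Proof. by move=> Qa; rewrite -hh_Q; exists a. Qed.

Lemma hh_inj (a b : R2 R) : Qsq R a -> Qsq R b -> hh a = hh b -> a = b.
Proof.
move=> Qa Qb ab; have [+ _] := hh_bilip a b Qa Qb.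
have -> : dist3 (hh a) (hh b) = 0.
  by rewrite ab /dist3 /norm3 /c1 /c2 /c3 /= !subrr !expr0n /= !addr0 sqrtr0.
rewrite ler_pdivrMr ?mul0r ?(lt_le_trans ltr01)// => d0.
have [] := abs_le_dist2 _ a b => h1 h2.
have /eqP := le_anti (introT andP (conj (le_trans h1 d0) (normr_ge0 _))).
have /eqP := le_anti (introT andP (conj (le_trans h2 d0) (normr_ge0 _))).
rewrite !normr_eq0 !subr_eq0 => /eqP e2 /eqP e1.
by rewrite (surjective_pairing a) (surjective_pairing b) e1 e2.
Qed.

Lemma hh_lip (a b : R2 R) : Qsq R a -> Qsq R b ->
  `|hh a - hh b| <= L * (`|a.1 - b.1| + `|a.2 - b.2|).
Proof.
move=> Qa Qb; have [_ h] := hh_bilip a b Qa Qb.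
apply: le_trans (norm_le_norm3 _ _) _; apply: le_trans h _.
by rewrite ler_wpM2l ?dist2_le// (le_trans ler01).
Qed.

Lemma hh_equator (a : R2 R) : Qsq R a -> c3 (hh a) = 0 <-> bdQ R a.
Proof.
move=> Qa; split => [h0|ba]; last first.
  by have [] : equator R (hh a) by rewrite -hh_bdQ; exists a.
have [b bb hb] : (hh @` bdQ R) (hh a).
  by rewrite hh_bdQ; split => //; have [] := hh_hemisphere _ Qa.
by rewrite -(hh_inj b a)// ; case: bb.
Qed.

Definition hinv (v : R3 R) : R2 R := xget (0, 0) [set a | Qsq R a /\ hh a = v].

Lemma hinvP (v : R3 R) : hemisphere R v -> Qsq R (hinv v) /\ hh (hinv v) = v.
Proof.
rewrite -hh_Q => -[a Qa av]; rewrite /hinv.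
by case: xgetP => [b _ []//|/(_ a)]; case.
Qed.

Lemma hinvK (a : R2 R) : Qsq R a -> hinv (hh a) = a.
Proof. by move=> Qa; have [Qv hv] := hinvP _ (hh_hemisphere _ Qa); apply: hh_inj. Qed.

Lemma hinv_lip (v w : R3 R) : hemisphere R v -> hemisphere R w ->
  `|(hinv v).1 - (hinv w).1| <= 2 * L * `|v - w| /\
  `|(hinv v).2 - (hinv w).2| <= 2 * L * `|v - w|.
Proof.
move=> hv hw; have [Qv ev] := hinvP v hv; have [Qw ew] := hinvP w hw.
have [+ _] := hh_bilip _ _ Qv Qw; rewrite ev ew dist3E => h.
have L0 := L_gt0.
have {}h : dist2 (hinv v) (hinv w) <= 2 * L * `|v - w|.
  move: h; rewrite ler_pdivrMr// => /le_trans; apply.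
  by rewrite [leRHS]mulrAC ler_wpM2r ?norm3_le_norm// ltW.
by have [] := abs_le_dist2 _ (hinv v) (hinv w); split; apply: le_trans h.
Qed.

Lemma Qsq_pair (s t : R) : -1 <= s <= 1 -> -1 <= t <= 1 -> Qsq R (s, t).
Proof. by split; rewrite ler_norml. Qed.

Lemma sqr_eq1P (s : R) : s ^+ 2 = 1 -> s = 1 \/ s = -1.
Proof. by move=> /eqP; rewrite sqrf_eq1 => /orP[/eqP->|/eqP->]; [left|right]. Qed.

(* [tau = 1] is the diagonal and [tau = -1] the antidiagonal: [hh] maps it
   onto the whole great semicircle of the hemisphere in the plane
   [x1 = tau * x2], by the intermediate value theorem. *)
Lemma hh_diagonals (tau : R) : tau ^+ 2 = 1 ->
  (forall t, -1 <= t <= 1 -> c1 (hh (t, tau * t)) = tau * c2 (hh (t, tau * t))) ->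
  [/\ c1 (hh (1, tau)) = - c1 (hh (-1, - tau)), c1 (hh (1, tau)) != 0 &
   forall a, Qsq R a -> c1 (hh a) = tau * c2 (hh a) -> a.2 = tau * a.1].
Proof.
move=> tau2 hd.
have tau1 := sqr_eq1P _ tau2.
have Qt t : -1 <= t <= 1 -> Qsq R (t, tau * t).
  by case: tau1 => -> ht; apply: Qsq_pair => //; lra.
have bd t : `|t| = 1 -> bdQ R (t, tau * t).
  move=> t1; have : `|t| <= 1 by rewrite t1.
  by rewrite ler_norml => ht; split; [exact: Qt|left].
have end_val t : `|t| = 1 -> 2 * c1 (hh (t, tau * t)) ^+ 2 = 1.
  move=> t1; have : `|t| <= 1 by rewrite t1.
  rewrite ler_norml => ht.
  have [eq1 eq2] : equator R (hh (t, tau * t)) by rewrite -hh_bdQ; exists (t, tau * t) => //; apply: bd.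
  have := sqr_norm3 _ (hh (t, tau * t)); rewrite eq1 eq2 hd//.
  rewrite exprMn tau2; lra.
have em : 2 * c1 (hh (-1, - tau)) ^+ 2 = 1.
  by have := end_val (-1); rewrite mulrN1 normrN1; apply.
have ep : 2 * c1 (hh (1, tau)) ^+ 2 = 1.
  by have := end_val 1; rewrite mulr1 normr1; apply.
(* On the semicircle the first coordinate determines the point: the plane gives the second one, and
   norm 1 with a nonnegative height gives the third. *)
have semi a t : Qsq R a -> -1 <= t <= 1 -> c1 (hh a) = tau * c2 (hh a) ->
    c1 (hh (t, tau * t)) = c1 (hh a) -> a = (t, tau * t).
  move=> Qa ht ha ta; apply: hh_inj => //; first exact: Qt.
  have e2 : c2 (hh a) = c2 (hh (t, tau * t)).
    move: ta; rewrite hd// ha => /(congr1 (fun z => tau * z)).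
    by rewrite !mulrA -expr2 tau2 !mul1r.
  apply: R3_eq => //.
  have [n1 p1] := hh_hemisphere _ Qa; have [n2 p2] := hh_hemisphere _ (Qt t ht).
  have := sqr_norm3 _ (hh a); have := sqr_norm3 _ (hh (t, tau * t)).
  rewrite n1 n2 ta e2 => -> /addrI /eqP; rewrite eqrXn2//.
  by move=> /eqP.
(* Both end values have square 1/2; if they were equal, [semi] would identify two opposite corners
   of the square. *)
have ends : c1 (hh (1, tau)) = - c1 (hh (-1, - tau)).
  have : c1 (hh (1, tau)) ^+ 2 = c1 (hh (-1, - tau)) ^+ 2 by lra.
  move/eqP; rewrite eqf_sqr => /orP[/eqP h|/eqP//].
  have H := semi (1, tau) (-1); rewrite mulrN1 in H.
  have : (1, tau) = (-1, - tau) :> R2 R.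
    apply: H; [|by lra| |by rewrite h].
      by have := Qt 1; rewrite mulr1; apply; lra.
    by have := hd 1; rewrite mulr1; apply; lra.
  by case; lra.
split => //.
  by apply/eqP => e0; move: ep; rewrite e0; lra.
move=> a Qa ha.
have [t ht ft] : exists2 t, -1 <= t <= 1 & c1 (hh (t, tau * t)) = c1 (hh a).
  apply: IVT_eps; first by lra.
    move=> t e ht e0; have L0 := L_gt0.
    exists (e / (2 * L)); first by rewrite divr_gt0// mulr_gt0.
    move=> t' ht'; rewrite ltr_pdivlMr ?mulr_gt0//.
    move=> tt'.
    have /le_lt_trans := hh_lip _ _ (Qt _ ht') (Qt _ ht) => /(_ e) h.
    apply: (le_lt_trans (c1_le_norm _ (hh (t', tau * t') - hh (t, tau * t)))).
    apply: h => /=; rewrite -mulrBr normrM.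
    have -> : `|tau| = 1 by case: tau1 => ->; rewrite ?normr1 ?normrN1.
    by rewrite mul1r; nra.
  rewrite mulrN1 mulr1 ends.
  have [n3 _] := hh_hemisphere _ Qa; have := sqr_norm3 _ (hh a); rewrite n3 ha exprMn tau2.
  rewrite -ha => n3'.
  have : c1 (hh a) ^+ 2 <= c1 (hh (-1, - tau)) ^+ 2.
    have : c2 (hh a) ^+ 2 = c1 (hh a) ^+ 2 by rewrite ha exprMn tau2 mul1r.
    by have := sqr_ge0 (c3 (hh a)); lra.
  rewrite -[X in X <= _]real_normK ?num_real// -[X in _ <= X]real_normK ?num_real//.
  rewrite ler_pXn2r ?nnegrE//.
  case: (lerP 0 (c1 (hh (-1, - tau)))) => s0; rewrite ?(ger0_norm s0) ?(ltr0_norm s0) ler_norml => h; [right|left]; lra.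
by rewrite (semi a t Qa ht ha ft).
Qed.

Lemma sgr_eq (x y : R) :
  y != 0 -> ~ (x <= 0 <= y) -> ~ (y <= 0 <= x) -> Num.sg x = Num.sg y.
Proof.
move=> y0 /negP xy /negP yx.
case: (ltgtP y 0) y0 => // sy _; case: (ltgtP x 0) => sx;
rewrite ?sx ?(ltr0_sg sy) ?(gtr0_sg sy) ?(ltr0_sg sx) ?(gtr0_sg sx)//.
- by rewrite (ltW sy) (ltW sx) in yx.
- by rewrite sx (ltW sy) lexx in yx.
- by rewrite (ltW sy) (ltW sx) in xy.
- by rewrite sx (ltW sy) lexx in xy.
Qed.

(** A segment between two points on the same side of the diagonal does not meet it, so by the
    intermediate value theorem [f] has constant sign on each side. The condition on the two corners
    makes these signs opposite. *)
Lemma sg_off_diagonal (f : R2 R -> R) (K : R) : 0 < K ->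
  (forall a b, Qsq R a -> Qsq R b ->
     `|f a - f b| <= K * (`|a.1 - b.1| + `|a.2 - b.2|)) ->
  (forall a, Qsq R a -> (f a == 0) = (a.1 == a.2)) ->
  f (1, -1) = - f (-1, 1) ->
  forall a, Qsq R a -> Num.sg (f a) = Num.sg (f (1, -1)) * Num.sg (a.1 - a.2).
Proof.
move=> K0 f_lip f0 fN.
have same (a b : R2 R) : Qsq R a -> Qsq R b -> 0 < (a.1 - a.2) * (b.1 - b.2) ->
    ~ (f a <= 0 <= f b).
  move=> Qa Qb ab /andP[fa fb].
  pose p (s : R) : R2 R := (a.1 + s * (b.1 - a.1), a.2 + s * (b.2 - a.2)).
  have Qp s : 0 <= s <= 1 -> Qsq R (p s).
    case: Qa => + +; case: Qb => + +; rewrite !ler_norml => ? ? ? ? ?.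
    by apply: Qsq_pair; nra.
  have [s hs ps] : exists2 s, 0 <= s <= 1 & f (p s) = 0.
    apply: IVT_eps => //; last by left; rewrite /p !mul0r !addr0 !mul1r ![_ + (_ - _)]addrC !subrK -!surjective_pairing fa.
    move=> t e ht e0.
    pose C := `|b.1 - a.1| + `|b.2 - a.2| + 1.
    have C0 : 0 < C by rewrite ltr_wpDl// addr_ge0.
    exists (e / (K * C)); first by rewrite divr_gt0// mulr_gt0.
    move=> t' ht'; rewrite ltr_pdivlMr ?mulr_gt0// => tt'.
    apply: le_lt_trans (f_lip _ _ (Qp _ ht') (Qp _ ht)) _; apply: le_lt_trans tt'.
    rewrite /p /= [X in `|X| + _](_ : _ = (t' - t) * (b.1 - a.1)); last by ring.
    rewrite [X in _ + `|X|](_ : _ = (t' - t) * (b.2 - a.2)); last by ring.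
    rewrite !normrM mulrCA ler_wpM2l ?(ltW K0)// -mulrDr ler_wpM2l// /C; lra.
  have := f0 _ (Qp s hs); rewrite ps eqxx => /esym/eqP /=.
  move=> ps0; have /andP[s0 s1] := hs.
  have a0 : 0 < (a.1 - a.2) ^+ 2.
    by rewrite exprn_even_gt0//=; apply: contraTneq ab => ->; rewrite mul0r ltxx.
  have : (1 - s) * (a.1 - a.2) ^+ 2 + s * ((a.1 - a.2) * (b.1 - b.2)) = 0.
    by transitivity ((a.1 - a.2) * ((a.1 + s * (b.1 - a.1)) - (a.2 + s * (b.2 - a.2)))); [ring|rewrite ps0 subrr mulr0].
  have [->|s_neq0] := eqVneq s 0; first by lra.
  have : 0 < s * ((a.1 - a.2) * (b.1 - b.2)) by rewrite mulr_gt0// lt_def s_neq0.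
  by have : 0 <= (1 - s) * (a.1 - a.2) ^+ 2 by [rewrite mulr_ge0 ?subr_ge0// ltW]; lra.
have f1 : f (1, -1) != 0.
  by rewrite f0/=; [apply/eqP; lra|apply: Qsq_pair; lra].
have Q1 : Qsq R (1, -1 : R) by apply: Qsq_pair; lra.
have Q2 : Qsq R (-1, 1 : R) by apply: Qsq_pair; lra.
move=> a Qa.
have [aa|aa|aa] := ltgtP a.1 a.2; last first.
- by rewrite aa subrr sgr0 mulr0; apply/eqP; rewrite sgr_eq0 f0 ?aa.
- rewrite (gtr0_sg (x := a.1 - a.2)) ?subr_gt0// mulr1.
  have H1 : 0 < (a.1 - a.2) * ((1 : R, -1 : R).1 - (1 : R, -1 : R).2).
    by rewrite /= opprK mulr_gt0 ?subr_gt0// addr_gt0.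
  have := same a (1, -1) Qa Q1 H1; rewrite mulrC in H1; have := same _ _ Q1 Qa H1.
  by move=> h1 h2; apply: sgr_eq.
- rewrite (ltr0_sg (x := a.1 - a.2)) ?subr_lt0// mulrN1 -sgrN fN opprK.
  rewrite fN oppr_eq0 in f1.
  have H1 : 0 < (a.1 - a.2) * ((-1 : R, 1 : R).1 - (-1 : R, 1 : R).2).
    by rewrite /= -opprD mulrN -mulNr opprB mulr_gt0 ?subr_gt0// addr_gt0.
  have := same a (-1, 1) Qa Q2 H1; rewrite mulrC in H1; have := same _ _ Q2 Qa H1.
  by move=> h1 h2; apply: sgr_eq.
Qed.

(** The sign [e] cannot be fixed: composing [hh] with the half-turn of the square keeps all
    assumptions and changes it. This is why only even iterates will be known to preserve the sectors
    between the diagonal planes. *)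
Lemma hh_sg_diff : exists2 e : R, e ^+ 2 = 1 &
  forall a, Qsq R a -> Num.sg (c1 (hh a) - c2 (hh a)) = e * Num.sg (a.1 - a.2).
Proof.
pose f a := c1 (hh a) - c2 (hh a).
have d1 t : -1 <= t <= 1 -> c1 (hh (t, 1 * t)) = 1 * c2 (hh (t, 1 * t)).
  by move=> ht; rewrite !mul1r hh_diag.
have d2 t : -1 <= t <= 1 -> c1 (hh (t, -1 * t)) = -1 * c2 (hh (t, -1 * t)).
  by move=> ht; rewrite !mulN1r hh_antidiag.
have [_ _ z1] := hh_diagonals 1 (expr1n _ _) d1.
have [f2 f2n _] := hh_diagonals (-1) (etrans (sqrrN _) (expr1n _ _)) d2.
have fE t : -1 <= t <= 1 -> f (t, - t) = 2 * c1 (hh (t, - t)).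
  by move=> ht; rewrite /f hh_antidiag//; ring.
have m1 : (-1 <= (1 : R) <= 1) by lra.
have m2 : (-1 <= (-1 : R) <= 1) by lra.
exists (Num.sg (f (1, -1))).
  rewrite fE// sqr_sg mulf_eq0 (negbTE f2n) orbF.
  by rewrite pnatr_eq0.
apply: (sg_off_diagonal f (2 * L)); first by rewrite mulr_gt0 ?L_gt0.
- move=> a b Qa Qb; have := hh_lip a b Qa Qb.
  have := c1_le_norm _ (hh a - hh b); have := c2_le_norm _ (hh a - hh b).
  rewrite -[c1 (_ - _)]/(c1 (hh a) - c1 (hh b)) -[c2 (_ - _)]/(c2 (hh a) - c2 (hh b)).
  move=> h1 h2 h3; rewrite /f.
  rewrite (_ : _ - _ - _ = (c1 (hh a) - c1 (hh b)) - (c2 (hh a) - c2 (hh b))); last by ring.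
  by apply: le_trans (ler_normB _ _) _; lra.
- move=> a Qa; apply/eqP/eqP => [/eqP|aa].
    by rewrite subr_eq0 => /eqP h; rewrite z1 ?mul1r.
  by case: Qa => + _; rewrite ler_norml => ha; rewrite /f [a]surjective_pairing -aa hh_diag ?subrr.
- have := fE (-1) m2; rewrite opprK => ->; rewrite fE// f2 opprK; ring.
Qed.

(** The reflection of the second coordinate turns the antidiagonal into the diagonal, so that
    [sg_off_diagonal] applies again. *)
Lemma hh_sg_sum : exists2 e : R, e ^+ 2 = 1 &
  forall a, Qsq R a -> Num.sg (c1 (hh a) + c2 (hh a)) = e * Num.sg (a.1 + a.2).
Proof.
pose f a := c1 (hh (a.1, - a.2)) + c2 (hh (a.1, - a.2)).
have d1 t : -1 <= t <= 1 -> c1 (hh (t, 1 * t)) = 1 * c2 (hh (t, 1 * t)).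
  by move=> ht; rewrite !mul1r hh_diag.
have d2 t : -1 <= t <= 1 -> c1 (hh (t, -1 * t)) = -1 * c2 (hh (t, -1 * t)).
  by move=> ht; rewrite !mulN1r hh_antidiag.
have [f2 f2n _] := hh_diagonals 1 (expr1n _ _) d1.
have [_ _ z1] := hh_diagonals (-1) (etrans (sqrrN _) (expr1n _ _)) d2.
have fE t : -1 <= t <= 1 -> f (t, - t) = 2 * c1 (hh (t, t)).
  by move=> ht; rewrite /f /= opprK hh_diag//; ring.
have m1 : (-1 <= (1 : R) <= 1) by lra.
have m2 : (-1 <= (-1 : R) <= 1) by lra.
have QN a : Qsq R a -> Qsq R (a.1, - a.2) by case=> ? ?; split => //=; rewrite normrN.
have sgf : forall a, Qsq R a -> Num.sg (f a) = Num.sg (f (1, -1)) * Num.sg (a.1 - a.2).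
  apply: (sg_off_diagonal f (2 * L)); first by rewrite mulr_gt0 ?L_gt0.
  - move=> a b Qa Qb; have := hh_lip _ _ (QN a Qa) (QN b Qb) => /=.
    rewrite [X in _ + `|X|](_ : _ = - (a.2 - b.2)); last by ring.
    rewrite normrN.
    set x := hh _; set y := hh _.
    have := c1_le_norm _ (x - y); have := c2_le_norm _ (x - y).
    rewrite -[c1 (_ - _)]/(c1 x - c1 y) -[c2 (_ - _)]/(c2 x - c2 y).
    move=> h1 h2 h3; rewrite /f -/x -/y.
    rewrite (_ : _ - _ = (c1 x - c1 y) + (c2 x - c2 y)); last by ring.
    by apply: le_trans (ler_normD _ _) _; lra.
  - move=> a Qa; apply/eqP/eqP => [/eqP|aa].
      rewrite /f addr_eq0 => /eqP h.
      have := z1 _ (QN a Qa); rewrite mulN1r => /(_ h) /=; lra.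
    case: Qa => + _; rewrite ler_norml => ha; rewrite /f -aa hh_antidiag//.
    by rewrite addNr.
  - have := fE (-1) m2; rewrite opprK => ->; rewrite fE// f2; ring.
exists (Num.sg (f (1, -1))).
  rewrite fE// sqr_sg mulf_eq0 (negbTE f2n) orbF.
  by rewrite pnatr_eq0.
move=> a Qa; have := sgf _ (QN a Qa).
by rewrite /f /= !opprK -surjective_pairing.
Qed.

Lemma hh_center : hh (0, 0) = (0, 0, 1).
Proof.
have m : (-1 <= (0 : R) <= 1) by lra.
have e1 := hh_diag _ m; have := hh_antidiag _ m; rewrite oppr0 => e2.
have h1 : c1 (hh (0, 0)) = 0 by lra.
have h2 : c2 (hh (0, 0)) = 0 by lra.
have [n p] := hh_hemisphere _ (Qsq_pair _ _ m m).
have := sqr_norm3 _ (hh (0, 0)); rewrite n h1 h2 expr0n /= !add0r => /esym/eqP.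
rewrite eqrXn2// => /eqP h3.
by apply: R3_eq.
Qed.

(** * Beams, and the inverse of [Z] on each of them *)

Lemma c_gt0 : 0 < c.
Proof. exact: lt_trans ltr01 c_gt1. Qed.

Local Notation Z := (zorich hh lam nu).

Definition parity (k : int) : R := (-1) ^+ absz k.

Lemma parityP (k : int) : parity k = 1 \/ parity k = -1.
Proof. by apply: sqr_eq1P; rewrite /parity sqrr_sign. Qed.

Lemma parity_sqr (k : int) : parity k * parity k = 1.
Proof. by case: (parityP k) => ->; rewrite ?mulr1// mulrNN mulr1. Qed.

Lemma parity_succ (k : int) : parity (k + 1) = - parity k.
Proof.
rewrite /parity; case: k => n.
  by rewrite -PoszD /= addn1 exprS mulN1r.
have -> : Negz n + 1 = - n%:Z by rewrite NegzE intS opprD addrAC addNr add0r.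
by rewrite abszN !absz_nat /= exprS mulN1r opprK.
Qed.

Lemma norm_parityM (k : int) (u : R) : `|parity k * u| = `|u|.
Proof. by case: (parityP k) => ->; rewrite ?mul1r ?mulN1r ?normrN. Qed.

(** Cells are half-open, so the right end [s = 1] already has the index of the next cell; the
    reflection there gives the same folded value. *)
Lemma fold_index_beam (k : int) (s : R) : -1 <= s <= 1 ->
  fold_index lam (2 * lam * k%:~R + lam * s) = k \/
  (s = 1 /\ fold_index lam (2 * lam * k%:~R + lam * s) = k + 1).
Proof.
move=> /andP[s0 s1]; have l0 := lam_gt0; rewrite /fold_index.
have -> : (2 * lam * k%:~R + lam * s + lam) / (2 * lam) = k%:~R + (s + 1) / 2.
  by field; rewrite lt0r_neq0.
move: s1; rewrite le_eqVlt => /orP[/eqP ->|s1].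
  right; split => //; rewrite (_ : (1 + 1) / 2 = (1 : R)); last by field.
  by rewrite -[1 in X in Num.floor X]/(1%:~R) -intrD intrKfloor.
by left; apply: floor_def; rewrite intrD; apply/andP; split; lra.
Qed.

Lemma fold_beam (k : int) (s : R) : -1 <= s <= 1 ->
  fold lam (2 * lam * k%:~R + lam * s) = parity k * (lam * s).
Proof.
move=> hs; rewrite /fold -/(parity _).
case: (fold_index_beam k s hs) => [->|[-> ->]]; first by congr (_ * _); ring.
by rewrite parity_succ intrD; ring.
Qed.

(** The coordinate [q] is reflected according to the parities of [k], so that in this
    parametrisation [Z] is given by the same [hh] on all beams, up to the sign [beam_sg k] of the
    height. *)
Definition beam_pt (k : int * int) (q : R2 R) (t : R) : R3 R :=
  (2 * lam * k.1%:~R + parity k.1 * (lam * q.1),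
   2 * lam * k.2%:~R + parity k.2 * (lam * q.2), t).

Definition beam_sg (k : int * int) : R := parity k.1 * parity k.2.

Lemma beam_sgP k : beam_sg k = 1 \/ beam_sg k = -1.
Proof.
rewrite /beam_sg; case: (parityP k.1) => ->; case: (parityP k.2) => ->;
rewrite ?mul1r ?mulN1r ?opprK; by [left|right].
Qed.

Lemma beam_sgK k : beam_sg k * beam_sg k = 1.
Proof. by case: (beam_sgP k) => ->; rewrite ?mulr1// mulrNN mulr1. Qed.

Lemma zorich_beam k q t : Qsq R q ->
  Z (beam_pt k q t) = (c * expR t * c1 (hh q), c * expR t * c2 (hh q),
                       c * expR t * (beam_sg k * c3 (hh q))).
Proof.
move=> Qq; have l0 : lam != 0 by rewrite lt0r_neq0 ?lam_gt0.
have parN (i : int) (s : R) : `|s| <= 1 -> -1 <= parity i * s <= 1.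
  by move=> hs; rewrite -ler_norml norm_parityM.
have q1 := parN k.1 _ Qq.1; have q2 := parN k.2 _ Qq.2.
have fE (i : int) (s : R) : `|s| <= 1 -> fold lam (2 * lam * i%:~R + parity i * (lam * s)) / lam = s.
  move=> hs; rewrite mulrCA fold_beam ?parN//.
  by transitivity (parity i * parity i * s); [field|rewrite parity_sqr mul1r].
rewrite /zorich /= !fE ?Qq.1 ?Qq.2// -surjective_pairing.
rewrite exprD -!/(parity _) -![nu * _ * lam]mulrAC -cE.
congr (_, _, _); congr (_ * _).
(* On a face of the beam the computed index may be that of a neighbour, but there the height is 0
   and its sign does not matter. *)
have [h3|h3] := eqVneq (c3 (hh q)) 0; first by rewrite h3 !mulr0.
have nb : ~ bdQ R q by move/(hh_equator _ Qq)/eqP; rewrite (negbTE h3).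
have idx (i : int) (s : R) : `|s| <= 1 -> `|s| <> 1 ->
    fold_index lam (2 * lam * i%:~R + parity i * (lam * s)) = i.
  move=> hs hs1; rewrite mulrCA; have [//|[ps _]] := fold_index_beam i _ (parN i s hs).
  by case: hs1; rewrite -(norm_parityM i) ps normr1.
by rewrite !idx//; [apply: Qq.2|move=> e; apply: nb; split => //; right|
  apply: Qq.1|move=> e; apply: nb; split => //; left].
Qed.

Definition dir (y : R3 R) : R3 R :=
  (c1 y / norm3 y, c2 y / norm3 y, `|c3 y| / norm3 y).

Lemma dir_hemisphere y : y != 0 -> hemisphere R (dir y).
Proof.
rewrite -norm3_gt0 => n0; split; last by rewrite /c3/= divr_ge0// ltW.
apply: norm3_eq => //; rewrite /c1/c2/c3/= !expr_div_n -!mulrDl real_normK ?num_real//.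
by rewrite -sqr_norm3 divff ?expr1n// sqrf_eq0 lt0r_neq0.
Qed.

(** Total in [y], but an inverse of [Z] only on the closed half-space onto which beam [k] is mapped;
    on the other one the absolute value in [dir] makes it the preimage of the mirror image. *)
Definition branch (k : int * int) (y : R3 R) : R3 R :=
  beam_pt k (hinv (dir y)) (ln (norm3 y / c)).

Lemma branchK k y : y != 0 -> 0 <= beam_sg k * c3 y -> Z (branch k y) = y.
Proof.
move=> y0 ky; have [Qq hq] := hinvP _ (dir_hemisphere _ y0).
have n0 : 0 < norm3 y by rewrite norm3_gt0.
rewrite /branch zorich_beam// hq lnK ?posrE ?divr_gt0 ?c_gt0//.
have -> : c * (norm3 y / c) = norm3 y by rewrite mulrC divfK// lt0r_neq0 ?c_gt0.
have nV u : norm3 y * (u / norm3 y) = u by rewrite mulrC divfK// lt0r_neq0.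
apply: R3_eq; rewrite [LHS]/= ?nV//.
rewrite -[RHS]nV; congr (_ * _); rewrite mulrA; congr (_ / _).
case: (beam_sgP k) ky => ->; rewrite ?mul1r ?mulN1r => h; first by rewrite ger0_norm.
by rewrite ler0_norm -?oppr_ge0// opprK.
Qed.

Lemma fold_index_itv x : `|x - 2 * lam * (fold_index lam x)%:~R| <= lam.
Proof.
have l0 := lam_gt0; have l2 : 0 < 2 * lam by rewrite mulr_gt0.
have /andP[] := floor_itv ((x + lam) / (2 * lam)); rewrite -/(fold_index lam x).
rewrite intrD ler_pdivlMr// ltr_pdivrMr// ler_norml.
by move=> h1 h2; apply/andP; split; lra.
Qed.

Lemma norm_fold x : `|fold lam x| = `|x - 2 * lam * (fold_index lam x)%:~R|.
Proof. by rewrite /fold norm_parityM. Qed.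

Lemma norm_fold_le x : `|fold lam x / lam| <= 1.
Proof.
have l0 := lam_gt0.
by rewrite normrM normfV (gtr0_norm l0) ler_pdivrMr// mul1r norm_fold fold_index_itv.
Qed.

Definition beam_of (x : R3 R) : int * int :=
  (fold_index lam (c1 x), fold_index lam (c2 x)).

Definition beam_coord (x : R3 R) : R2 R :=
  (fold lam (c1 x) / lam, fold lam (c2 x) / lam).

Lemma beam_coord_Q x : Qsq R (beam_coord x).
Proof. by split; apply: norm_fold_le. Qed.

Lemma beam_ptK x : beam_pt (beam_of x) (beam_coord x) (c3 x) = x.
Proof.
have l0 : lam != 0 by rewrite lt0r_neq0 ?lam_gt0.
have H u : 2 * lam * (fold_index lam u)%:~R + parity (fold_index lam u) * (lam * (fold lam u / lam)) = u.
  rewrite /fold -/(parity _) [lam * _]mulrC divfK// mulrA parity_sqr mul1r.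
  by rewrite addrC subrK.
by apply: R3_eq; rewrite /beam_pt [LHS]/= ?H.
Qed.

Lemma zorichE x : Z x = (c * expR (c3 x) * c1 (hh (beam_coord x)),
  c * expR (c3 x) * c2 (hh (beam_coord x)),
  c * expR (c3 x) * (beam_sg (beam_of x) * c3 (hh (beam_coord x)))).
Proof. by rewrite -{1}(beam_ptK x) zorich_beam//; apply: beam_coord_Q. Qed.

Lemma norm3_zorich x : norm3 (Z x) = c * expR (c3 x).
Proof.
apply: norm3_eq; first by rewrite mulr_ge0 ?expR_ge0// ltW ?c_gt0.
have [n1 _] := hh_hemisphere _ (beam_coord_Q x).
have := sqr_norm3 _ (hh (beam_coord x)); rewrite n1 => n2.
rewrite zorichE /c1 /c2 /c3 [in LHS]/=.
rewrite -[RHS]mulr1 -(expr1n _ 2) n2 /c1/c2/c3.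
have := beam_sgK (beam_of x).
by case: (beam_sgP (beam_of x)) => -> _; ring.
Qed.

Lemma zorich_neq0 x : Z x != 0.
Proof. by rewrite -norm3_gt0 norm3_zorich mulr_gt0 ?c_gt0 ?expR_gt0. Qed.

Lemma zorich_side x : 0 <= beam_sg (beam_of x) * c3 (Z x).
Proof.
have [_ h3] := hh_hemisphere _ (beam_coord_Q x).
rewrite zorichE [c3 (_, _, _)]/= mulrCA [beam_sg _ * (_ * _)]mulrA beam_sgK mul1r.
by rewrite mulr_ge0// mulr_ge0 ?expR_ge0// ltW ?c_gt0.
Qed.

Lemma branch_zorich x : branch (beam_of x) (Z x) = x.
Proof.
have c0 := c_gt0; have n0 : 0 < c * expR (c3 x) by rewrite mulr_gt0 ?expR_gt0.
rewrite /branch norm3_zorich.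
have -> : c * expR (c3 x) / c = expR (c3 x) by rewrite mulrAC divff ?mul1r ?lt0r_neq0.
rewrite expRK; suff -> : dir (Z x) = hh (beam_coord x) by rewrite hinvK ?beam_ptK//; apply: beam_coord_Q.
have [_ h3] := hh_hemisphere _ (beam_coord_Q x).
have H u : c * expR (c3 x) * u / (c * expR (c3 x)) = u by rewrite mulrAC divff ?mul1r ?lt0r_neq0.
rewrite /dir norm3_zorich zorichE; apply: R3_eq; rewrite [LHS]/= ?H//.
rewrite normrM (gtr0_norm n0) H normrM [`|c3 _|]ger0_norm//.
by case: (beam_sgP (beam_of x)) => ->; rewrite ?normrN1 ?normr1 mul1r.
Qed.

(** * Lipschitz bounds for the branches, and continuity of [Z] *)

Lemma ln_ratio_le (r e : R) : 0 <= e <= 1 / 2 -> `|r - 1| <= e -> `|ln r| <= 2 * e.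
Proof.
move=> /andP[e0 e1]; rewrite ler_norml => /andP[r1 r2].
have r0 : 0 < r by lra.
have h1 : ln r <= r - 1 by have := @le_ln1Dx R (r - 1); rewrite addrCA subrr addr0; apply; lra.
have h2 : - ln r <= r^-1 - 1.
  by rewrite -lnV ?posrE//; have := @le_ln1Dx R (r^-1 - 1); rewrite addrCA subrr addr0; apply; rewrite -subr_gt0 opprK subrK invr_gt0.
have h3 : r^-1 - 1 <= 2 * e.
  rewrite lerBlDr -[r^-1]mul1r ler_pdivrMr//; nra.
by rewrite ler_norml; apply/andP; split; lra.
Qed.

(** The product of 3 (normalisation in [dir]), 2 L ([hinv_lip]) and the scale [lam] of the beams; it
    also dominates the constant 4 of the logarithmic coordinate. *)
Definition lipK : R := 6 * L * lam.

Lemma lipK_ge6 : 6 <= lipK.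
Proof. by rewrite /lipK -mulrA ler_pMr// mulr_ege1. Qed.

Lemma near_neq0 (y y' : R3 R) : y != 0 -> `|y' - y| <= norm3 y / 4 -> y' != 0.
Proof.
rewrite -!norm3_gt0 => n0 h; have := norm3_lip _ y' y.
by rewrite ler_norml => /andP[] *; lra.
Qed.

(** The bound 1/4 keeps the ratio of the Euclidean norms within 1/2 of 1, the range of
    [ln_ratio_le]. *)
Lemma branch_lip k y y' : y != 0 -> `|y' - y| <= norm3 y / 4 ->
  `|branch k y' - branch k y| <= lipK * (`|y' - y| / norm3 y).
Proof.
move=> y0 yy'; have y'0 := near_neq0 _ _ y0 yy'.
have n0 : 0 < norm3 y by rewrite norm3_gt0.
have n'0 : 0 < norm3 y' by rewrite norm3_gt0.
have nn := norm3_lip _ y' y.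
set d := `|y' - y| in yy' nn *; set e := d / norm3 y.
have d0 : 0 <= d by exact: normr_ge0.
have e0 : 0 <= e by rewrite divr_ge0// ltW.
have L0 := L_gt0; have l0 := lam_gt0.
have dE : d = e * norm3 y by rewrite divfK// lt0r_neq0.
have quot u u' : `|u' - u| <= d -> `|u'| <= norm3 y' ->
    `|u' / norm3 y' - u / norm3 y| <= 3 * e.
  move=> h1 h2.
  have -> : u' / norm3 y' - u / norm3 y =
      (u' - u) / norm3 y + u' / norm3 y' * ((norm3 y - norm3 y') / norm3 y).
    by field; rewrite !lt0r_neq0.
  have h3 : `|(u' - u) / norm3 y| <= e.
    by rewrite normrM normfV (gtr0_norm n0) ler_wpM2r// invr_ge0 ltW.
  have h4 : `|u' / norm3 y'| <= 1.
    by rewrite normrM normfV (gtr0_norm n'0) ler_pdivrMr// mul1r.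
  have h5 : `|(norm3 y - norm3 y') / norm3 y| <= 2 * e.
    rewrite normrM normfV (gtr0_norm n0) /e mulrA ler_wpM2r ?invr_ge0 ?(ltW n0)//.
    by rewrite distrC.
  apply: le_trans (ler_normD _ _) _.
  have -> : 3 * e = e + 1 * (2 * e) by ring.
  by apply: lerD => //; rewrite normrM; apply: ler_pM.
have dd : `|dir y' - dir y| <= 3 * e.
  have le3 := norm_le_norm3 _ y'.
  apply: norm_ler; apply: quot.
  - exact: (c1_le_norm _ (y' - y)).
  - exact: le_trans (c1_le_norm _ _) le3.
  - exact: (c2_le_norm _ (y' - y)).
  - exact: le_trans (c2_le_norm _ _) le3.
  - apply: le_trans (ler_dist_dist _ _) _; exact: (c3_le_norm _ (y' - y)).
  - by rewrite normr_id; apply: le_trans (c3_le_norm _ _) le3.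
have [q1 q2] := hinv_lip _ _ (dir_hemisphere _ y'0) (dir_hemisphere _ y0).
have coord i (u u' : R) : `|u' - u| <= 2 * L * `|dir y' - dir y| ->
    `|2 * lam * i%:~R + parity i * (lam * u') - (2 * lam * i%:~R + parity i * (lam * u))|
      <= lipK * e.
  move=> h; have -> : 2 * lam * i%:~R + parity i * (lam * u') - (2 * lam * i%:~R + parity i * (lam * u)) = parity i * (lam * (u' - u)) by ring.
  rewrite norm_parityM normrM (gtr0_norm l0) /lipK.
  have -> : 6 * L * lam * e = lam * (2 * L * (3 * e)) by ring.
  rewrite ler_wpM2l ?(ltW l0)//; apply: le_trans h _.
  by rewrite ler_wpM2l// mulr_ge0// ltW.
apply: norm_ler; [exact: coord q1|exact: coord q2|].
rewrite /c3/= -ln_div ?posrE ?divr_gt0 ?c_gt0//.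
have -> : norm3 y' / c / (norm3 y / c) = norm3 y' / norm3 y.
  by field; rewrite !lt0r_neq0 ?c_gt0.
apply: (@le_trans _ _ (2 * (2 * e))); last by have := lipK_ge6; nra.
apply: ln_ratio_le.
  by rewrite mulr_ge0//=; move: yy'; rewrite dE; nra.
have -> : norm3 y' / norm3 y - 1 = (norm3 y' - norm3 y) / norm3 y.
  by field; rewrite lt0r_neq0.
by rewrite normrM normfV (gtr0_norm n0) ler_pdivrMr// -mulrA -dE.
Qed.

(** The left side is the distance from [x] to the boundary of its cell. *)
Lemma norm_fold_inner x y : fold_index lam x <> fold_index lam y ->
  lam - `|fold lam x| <= `|x - y|.
Proof.
move=> xy; rewrite leNgt norm_fold; apply/negP => h; apply: xy.
set k := fold_index lam x in h *; apply/esym.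
have l0 := lam_gt0; have l2 : 0 < 2 * lam by rewrite mulr_gt0.
have : `|y - 2 * lam * k%:~R| < lam.
  rewrite (_ : y - _ = (x - 2 * lam * k%:~R) - (x - y)); last by ring.
  by apply: le_lt_trans (ler_normB _ _) _; lra.
rewrite ltr_norml => /andP[h1 h2].
by apply: floor_def; rewrite intrD ler_pdivlMr// ltr_pdivrMr//; apply/andP; split; lra.
Qed.

Lemma fold_lip_le x y : x <= y -> `|fold lam x - fold lam y| <= y - x.
Proof.
move=> xy; have l0 := lam_gt0; have l2 : 0 < 2 * lam by rewrite mulr_gt0.
have ix := fold_index_itv x; have iy := fold_index_itv y.
have kk : fold_index lam x <= fold_index lam y.
  by apply: le_floor; rewrite ler_wpM2r ?invr_ge0 ?(ltW l2)// lerD2r.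
have fx : fold lam x = parity (fold_index lam x) * (x - 2 * lam * (fold_index lam x)%:~R) by [].
have fy : fold lam y = parity (fold_index lam y) * (y - 2 * lam * (fold_index lam y)%:~R) by [].
have nx := norm_fold x; have ny := norm_fold y.
set k := fold_index lam x in ix kk fx nx; set k' := fold_index lam y in iy kk fy ny.
have [e|kk'] := eqVneq k k'.
  rewrite fx fy e -mulrBr norm_parityM distrC.
  by rewrite (_ : _ - _ - _ = y - x); [rewrite ger0_norm ?subr_ge0|ring].
have {kk'}kk : k + 1 <= k' by rewrite lezD1 lt_neqAle kk' kk.
move: ix iy; rewrite !ler_norml => /andP[ix1 ix2] /andP[iy1 iy2].
have [e|kk'] := eqVneq (k + 1) k'.
  move: iy1 iy2; rewrite fx fy -e parity_succ intrD => iy1 iy2.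
  have -> : parity k * (x - 2 * lam * k%:~R) - - parity k * (y - 2 * lam * (k%:~R + 1%:~R)) =
      parity k * (x - 2 * lam * k%:~R + (y - 2 * lam * (k%:~R + 1%:~R))) by ring.
  rewrite -ler_norml norm_parityM ler_norml.
  by apply/andP; split; lra.
(* A full cell of width [2 * lam] separates the two points, while both folded values have size at
   most [lam]. *)
have {kk'}kk2 : k + 1 + 1 <= k' by rewrite lezD1 lt_neqAle kk' kk.
rewrite -ler_norml; have : (k + 1 + 1)%:~R <= k'%:~R :> R by rewrite ler_int.
rewrite !intrD => kR.
have h : lam * (k%:~R + 1 + 1) <= lam * k'%:~R by rewrite ler_wpM2l// ltW.
apply: le_trans (ler_normB _ _) _; rewrite nx ny.
have h1 := fold_index_itv x; have h2 := fold_index_itv y; rewrite -/k in h1; rewrite -/k' in h2.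
lra.
Qed.

Lemma fold_lip x y : `|fold lam x - fold lam y| <= `|x - y|.
Proof.
have [xy|/ltW xy] := leP x y.
  by apply: le_trans (fold_lip_le _ _ xy) _; rewrite distrC ler_norm.
by rewrite distrC; apply: le_trans (fold_lip_le _ _ xy) _; rewrite ler_norm.
Qed.

(** Compare [q] with a nearest point on a side of the square, where the height vanishes. *)
Lemma hh_height q : Qsq R q ->
  c3 (hh q) <= L * (1 - `|q.1|) /\ c3 (hh q) <= L * (1 - `|q.2|).
Proof.
move=> [q1 q2]; have Qq : Qsq R q by [].
pose u (s : R) : R := if 0 <= s then 1 else -1.
have u1 s : `|u s| = 1 by rewrite /u; case: ifP; rewrite ?normrN1 ?normr1.
have us s : `|s| <= 1 -> `|s - u s| <= 1 - `|s|.
  rewrite /u; case: ifPn => s0.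
    by rewrite distrC (ger0_norm s0) => s1; rewrite ger0_norm ?subr_ge0.
  rewrite -ltNge in s0; rewrite (ltr0_norm s0) opprK => s1.
  by rewrite ger0_norm; lra.
have H b : bdQ R b -> c3 (hh q) <= L * (`|q.1 - b.1| + `|q.2 - b.2|).
  move=> bb; have Qb : Qsq R b by case: bb.
  have h0 : c3 (hh b) = 0 by apply/(hh_equator _ Qb).
  apply: le_trans (hh_lip _ _ Qq Qb).
  apply: le_trans (c3_le_norm _ (hh q - hh b)); rewrite -[c3 (_ - _)]/(c3 (hh q) - c3 (hh b)).
  by rewrite h0 subr0 ler_norm.
split.
  have /H /= h : bdQ R (u q.1, q.2) by split; [split; rewrite /= ?u1|left; rewrite /= u1].
  apply: le_trans h _; rewrite subrr normr0 addr0 ler_wpM2l ?us//.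
  exact: ltW L_gt0.
have /H /= h : bdQ R (q.1, u q.2) by split; [split; rewrite /= ?u1|right; rewrite /= u1].
apply: le_trans h _; rewrite subrr normr0 add0r ler_wpM2l ?us//.
exact: ltW L_gt0.
Qed.

Lemma beam_coord_lip x x' :
  `|(beam_coord x).1 - (beam_coord x').1| <= `|x - x'| /\
  `|(beam_coord x).2 - (beam_coord x').2| <= `|x - x'|.
Proof.
have l0 := lam_gt0.
have H u u' : `|u - u'| <= `|x - x'| -> `|fold lam u / lam - fold lam u' / lam| <= `|x - x'|.
  rewrite -mulrBl normrM normfV (gtr0_norm l0) ler_pdivrMr// => h.
  apply: le_trans (fold_lip _ _) _; apply: le_trans h _.
  by rewrite ler_peMr.
by split; apply: H; [exact: (c1_le_norm _ (x - x'))|exact: (c2_le_norm _ (x - x'))].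
Qed.

(** A point with a partner in another beam is at least as close to a face as to the partner, and
    heights vanish on faces. This absorbs the jump of [beam_sg] in [zdir_lip]. *)
Lemma height_beam_change x x' : beam_of x <> beam_of x' ->
  0 <= c3 (hh (beam_coord x)) <= L * `|x - x'|.
Proof.
have Qx := beam_coord_Q x; have [_ ->] := hh_hemisphere _ Qx => bb /=.
have [h1 h2] := hh_height _ Qx; have l0 := lam_gt0.
have H u u' : fold_index lam u <> fold_index lam u' -> `|u - u'| <= `|x - x'| ->
    L * (1 - `|fold lam u / lam|) <= L * `|x - x'|.
  move=> uu' hu; rewrite ler_wpM2l ?(ltW L_gt0)//; apply: le_trans hu.
  apply: le_trans (_ : (lam - `|fold lam u|) / lam <= _).
    by rewrite mulrBl divff ?lt0r_neq0// normrM normfV (gtr0_norm l0).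
  rewrite ler_pdivrMr//; apply: le_trans (norm_fold_inner _ _ uu') _.
  by rewrite ler_peMr.
have [e1|e1] := eqVneq (fold_index lam (c1 x)) (fold_index lam (c1 x')).
  have [e2|/eqP e2] := eqVneq (fold_index lam (c2 x)) (fold_index lam (c2 x')).
    by case: bb; rewrite /beam_of e1 e2.
  apply: le_trans h2 _; apply: H e2 _; exact: (c2_le_norm _ (x - x')).
apply: le_trans h1 _; apply: H (elimN eqP e1) _; exact: (c1_le_norm _ (x - x')).
Qed.

Definition zdir (x : R3 R) : R3 R :=
  (c1 (hh (beam_coord x)), c2 (hh (beam_coord x)),
   beam_sg (beam_of x) * c3 (hh (beam_coord x))).

Lemma zdir_lip x x' : `|zdir x - zdir x'| <= 2 * L * `|x - x'|.
Proof.
have L0 := L_gt0.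
have [q1 q2] := beam_coord_lip x x'.
have h : `|hh (beam_coord x) - hh (beam_coord x')| <= 2 * L * `|x - x'|.
  apply: le_trans (hh_lip _ _ (beam_coord_Q x) (beam_coord_Q x')) _.
  have -> : 2 * L * `|x - x'| = L * (2 * `|x - x'|) by ring.
  by rewrite ler_wpM2l ?(ltW L0)//; lra.
apply: norm_ler.
- exact: le_trans (c1_le_norm _ (hh (beam_coord x) - hh (beam_coord x'))) h.
- exact: le_trans (c2_le_norm _ (hh (beam_coord x) - hh (beam_coord x'))) h.
rewrite -[c3 (_ - _)]/(beam_sg (beam_of x) * c3 (hh (beam_coord x)) - beam_sg (beam_of x') * c3 (hh (beam_coord x'))).
have sgn k u : `|beam_sg k * u| = `|u|.
  by case: (beam_sgP k) => ->; rewrite ?mul1r ?mulN1r ?normrN.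
have [e|/eqP e] := eqVneq (beam_of x) (beam_of x').
  rewrite e -mulrBr sgn.
  exact: le_trans (c3_le_norm _ (hh (beam_coord x) - hh (beam_coord x'))) h.
have /andP[a1 a2] := height_beam_change _ _ e.
have /andP[b1 b2] := height_beam_change _ _ (nesym e).
apply: le_trans (ler_normB _ _) _; rewrite !sgn !ger0_norm//.
by rewrite [`|x' - x|]distrC in b2; lra.
Qed.

Definition cont_at (f : R3 R -> R3 R) (x : R3 R) := forall e : R, 0 < e ->
  exists2 d : R, 0 < d & forall x', `|x' - x| < d -> `|f x' - f x| < e.

Lemma cont_at_comp f g x : cont_at f x -> cont_at g (f x) ->
  cont_at (fun y => g (f y)) x.
Proof.
move=> cf cg e /cg[d /cf[d' d'0 h'] h].
by exists d' => // x' /h' /h.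
Qed.

Lemma expR_cont (t e : R) : 0 < e ->
  exists2 d : R, 0 < d & forall t', `|t' - t| < d -> `|expR t' - expR t| < e.
Proof.
move=> e0; have /cvgrPdist_lt/(_ e e0)/nbhs_ballP[d /= d0 h] := @continuous_expR R t.
by exists d => // t' tt'; rewrite distrC; apply: h; rewrite /ball/= distrC.
Qed.

Lemma zorich_cont x : cont_at Z x.
Proof.
move=> e e0; have c0 := c_gt0; have L0 := L_gt0.
have [A AE] : exists A, A = c * expR (c3 x) by eexists.
have A0 : 0 < A by rewrite AE mulr_gt0 ?expR_gt0.
have [d d0 hd] := expR_cont (c3 x) (e / 2 / c) (divr_gt0 (divr_gt0 e0 (ltr0Sn _ 1)) c0).
set d' := e / 2 / (A * (2 * L)).
have d'0 : 0 < d' by exact: divr_gt0 (divr_gt0 e0 (ltr0Sn _ 1)) (mulr_gt0 A0 (mulr_gt0 (ltr0Sn _ 1) L0)).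
exists (Num.min d d'); first by rewrite lt_min d0.
move=> x'; rewrite lt_min => /andP[xd xd'].
have B1 : `|c * expR (c3 x') - A| < e / 2.
  rewrite AE -mulrBr normrM (gtr0_norm c0) mulrC -ltr_pdivlMr//.
  by apply: hd; apply: le_lt_trans (c3_le_norm _ (x' - x)) xd.
have B2 : A * `|zdir x' - zdir x| < e / 2.
  have := zdir_lip x' x; move: xd'; rewrite /d' ltr_pdivlMr; last by exact: mulr_gt0 A0 (mulr_gt0 (ltr0Sn _ 1) L0).
  move=> h1 h2.
  apply: le_lt_trans h1; rewrite mulrCA ler_wpM2l ?(ltW A0)//.
  by rewrite mulrC.
have zd1 : `|zdir x'| <= 1.
  have [n1 _] := hh_hemisphere _ (beam_coord_Q x').
  have := norm_le_norm3 _ (hh (beam_coord x')); rewrite n1 => h.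
  apply: norm_ler; [exact: le_trans (c1_le_norm _ _) h|exact: le_trans (c2_le_norm _ _) h|].
  apply: le_trans h; apply: le_trans (c3_le_norm _ _).
  by rewrite [c3 (zdir _)]/=; case: (beam_sgP (beam_of x')) => ->; rewrite ?mul1r ?mulN1r ?normrN.
have comp (u u' : R) : `|u'| <= `|zdir x'| -> `|u' - u| <= `|zdir x' - zdir x| ->
    `|c * expR (c3 x') * u' - A * u| < e.
  move=> h1 h2.
  have -> : c * expR (c3 x') * u' - A * u = (c * expR (c3 x') - A) * u' + A * (u' - u) by ring.
  apply: le_lt_trans (ler_normD _ _) _; rewrite !normrM (gtr0_norm A0).
  have h3 : `|c * expR (c3 x') - A| * `|u'| <= `|c * expR (c3 x') - A|.
    by rewrite ler_piMr// (le_trans h1).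
  have h4 : A * `|u' - u| <= A * `|zdir x' - zdir x| by rewrite ler_wpM2l// ltW.
  by lra.
rewrite !zorichE -AE; apply: norm_ltr; apply: comp.
- exact: (c1_le_norm _ (zdir x')).
- exact: (c1_le_norm _ (zdir x' - zdir x)).
- exact: (c2_le_norm _ (zdir x')).
- exact: (c2_le_norm _ (zdir x' - zdir x)).
- exact: (c3_le_norm _ (zdir x')).
- exact: (c3_le_norm _ (zdir x' - zdir x)).
Qed.

Lemma iter_zorich_cont n x : cont_at (iter n Z) x.
Proof.
elim: n => [|n IH]; first by move=> e e0; exists e.
by apply: cont_at_comp IH (zorich_cont _).
Qed.

(** * Crossing a face, and openness of [Z] *)

(** The value [s = parity i] is the upper face of cell [i], which is the lower face of the next
    cell; both reflected coordinates agree on it. *)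
Lemma face_coord (i : int) (s : R) : s = parity i ->
  2 * lam * i%:~R + parity i * (lam * s) =
  2 * lam * (i + 1)%:~R + parity (i + 1) * (lam * s).
Proof.
move=> ->; rewrite parity_succ intrD.
have := parity_sqr i; set p := parity i => pp.
transitivity (2 * lam * i%:~R + lam * (p * p)); first by ring.
transitivity (2 * lam * (i%:~R + 1) - lam * (p * p)); last by ring.
by rewrite pp; ring.
Qed.

Lemma neighbour_coord (i : int) (s : R) : `|s| = 1 ->
  exists2 i' : int, parity i' = - parity i &
   2 * lam * i%:~R + parity i * (lam * s) = 2 * lam * i'%:~R + parity i' * (lam * s).
Proof.
move=> s1; have : (s == parity i) || (s == - parity i).
  rewrite -eqf_sqr -[s ^+ 2]real_normK ?num_real// s1 expr1n.
  by rewrite expr2 parity_sqr.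
case/orP => /eqP si; first by exists (i + 1); [rewrite parity_succ|exact: face_coord].
have pi' : parity (i - 1) = - parity i by rewrite -[in RHS](subrK 1 i) parity_succ opprK.
exists (i - 1) => //.
by rewrite (face_coord (i - 1)) ?subrK// pi'.
Qed.

Lemma hinv_dir_boundary y : y != 0 -> c3 y = 0 -> bdQ R (hinv (dir y)).
Proof.
move=> y0 h3; have [Qq hq] := hinvP _ (dir_hemisphere _ y0).
by apply/(hh_equator _ Qq); rewrite hq /dir /c3/= -/(c3 y) h3 normr0 mul0r.
Qed.

Lemma branch_face k y : y != 0 -> c3 y = 0 ->
  exists2 k', beam_sg k' = - beam_sg k & branch k' y = branch k y.
Proof.
move=> y0 /(hinv_dir_boundary _ y0)[_]; rewrite /branch /beam_pt.
case=> /neighbour_coord => [/(_ k.1)|/(_ k.2)] [i ip ie].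
  by exists (i, k.2); rewrite ?[LHS]/= -?ie// /beam_sg/= ip mulNr.
by exists (k.1, i); rewrite ?[LHS]/= -?ie// /beam_sg/= ip mulrN.
Qed.

(** The branch through [x] reaches [y'] unless the plane x3 = 0 lies between; then the neighbouring
    beam takes over. The bound 1/8 leaves room for two applications of [branch_lip], and 3 = 1 + 2
    since the norm drops at most by half on the way. *)
Lemma zorich_open x y' : `|y' - Z x| <= norm3 (Z x) / 8 ->
  exists2 x', Z x' = y' & `|x' - x| <= 3 * lipK * (`|y' - Z x| / norm3 (Z x)).
Proof.
set y := Z x; set k := beam_of x; have y0 : y != 0 by exact: zorich_neq0.
have n0 : 0 < norm3 y by rewrite norm3_gt0.
have xk : branch k y = x by exact: branch_zorich.
have K6 := lipK_ge6; set d := `|y' - y| => dn.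
have d0 : 0 <= d by exact: normr_ge0.
have dn4 : d <= norm3 y / 4 by lra.
have y'0 := near_neq0 _ _ y0 dn4.
have [ky'|ky'] := leP 0 (beam_sg k * c3 y').
  exists (branch k y'); first exact: branchK.
  rewrite -xk; apply: le_trans (branch_lip k _ _ y0 dn4) _.
  by rewrite ler_wpM2r ?divr_ge0 ?norm3_ge0//; lra.
(* The foot of [y'] on the plane is the point where the branch is changed; since [y] and [y'] lie on
   different sides, it is within [d] of both. *)
pose y1 : R3 R := (c1 y', c2 y', 0).
have h3 : `|c3 y| <= d /\ `|c3 y'| <= d.
  have /(le_trans _) h : `|c3 y' - c3 y| <= d by exact: (c3_le_norm _ (y' - y)).
  have := zorich_side x; rewrite -/k -/y.
  case: (beam_sgP k) ky' => ->; rewrite ?mul1r ?mulN1r => h1 h2; split; apply: h.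
  - rewrite (ger0_norm h2) ler0_norm; lra.
  - rewrite (ltr0_norm h1) ler0_norm; lra.
  - rewrite oppr_ge0 in h2; rewrite oppr_lt0 in h1; rewrite (ler0_norm h2) ger0_norm; lra.
  - rewrite oppr_ge0 in h2; rewrite oppr_lt0 in h1; rewrite (gtr0_norm h1) ger0_norm; lra.
have e1 : `|y1 - y| <= d.
  apply: norm_ler; [exact: (c1_le_norm _ (y' - y))|exact: (c2_le_norm _ (y' - y))|].
  by rewrite /c3/= sub0r normrN; case: h3.
have e2 : `|y' - y1| <= d.
  by apply: norm_ler; rewrite /c1/c2/c3/= ?subrr ?normr0// subr0; case: h3.
have y10 : y1 != 0 by apply: near_neq0 y0 _; lra.
have := norm3_lip _ y1 y; rewrite ler_norml => /andP[n1 _].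
have n10 : 0 < norm3 y1 by rewrite norm3_gt0.
have [k' kk' bk'] := branch_face k y1 y10 erefl.
exists (branch k' y'); first by apply: branchK => //; rewrite kk' mulNr oppr_ge0 ltW.
have d1 : `|y1 - y| <= norm3 y / 4 by lra.
have d2 : `|y' - y1| <= norm3 y1 / 4 by lra.
have b1 := branch_lip k y y1 y0 d1; have b2 := branch_lip k' y1 y' y10 d2.
rewrite bk' in b2; rewrite xk in b1.
have -> : branch k' y' - x = (branch k' y' - branch k y1) + (branch k y1 - x).
  by rewrite addrA subrK.
apply: le_trans (ler_normD _ _) _.
have b3 : lipK * (`|y1 - y| / norm3 y) <= lipK * (d / norm3 y).
  by rewrite ler_wpM2l ?ler_wpM2r ?invr_ge0//; lra.
have b4 : lipK * (`|y' - y1| / norm3 y1) <= lipK * (2 * (d / norm3 y)).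
  rewrite ler_wpM2l//; first by lra.
  rewrite mulrA ler_pdivrMr// mulrAC ler_pdivlMr//.
  by apply: (@le_trans _ _ (d * norm3 y)); [rewrite ler_wpM2r// ltW|nra].
lra.
Qed.

(** * Axes, heights and the escaping set *)

Definition axis (k : int * int) (t : R) : R3 R :=
  (2 * lam * k.1%:~R, 2 * lam * k.2%:~R, t).

Lemma axisE k t : axis k t = beam_pt k (0, 0) t.
Proof. by rewrite /axis /beam_pt /= !mulr0 !addr0. Qed.

Lemma Qsq0 : Qsq R (0, 0).
Proof. by apply: Qsq_pair; rewrite lerN10 ler01. Qed.

Lemma zorich_axis k t : Z (axis k t) = (0, 0, beam_sg k * (c * expR t)).
Proof.
rewrite axisE (zorich_beam _ _ _ Qsq0) hh_center.
by apply: R3_eq; rewrite /c1 /c2 /c3 /= ?mulr0// mulr1 mulrC.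
Qed.

Lemma branch_axis k t : t != 0 -> branch k (0, 0, t) = axis k (ln (`|t| / c)).
Proof.
move=> t0; have nt : norm3 (0, 0, t) = `|t|.
  by apply: norm3_eq => //; rewrite /c1/c2/c3/= expr0n /= !add0r real_normK ?num_real.
rewrite /branch /dir nt axisE /c1/c2/c3/= !mul0r divff ?normr_eq0//.
by rewrite -hh_center hinvK//; apply: Qsq0.
Qed.

Lemma axis0E t : axis (0, 0) t = (0, 0, t).
Proof. by rewrite /axis !mulr0z mulr0. Qed.

Lemma beam_sg0 : beam_sg (0, 0) = 1.
Proof. by rewrite /beam_sg /parity /= expr0 mulr1. Qed.

Lemma zorich_preaxis x t : Z x = (0, 0, t) -> exists k, x = axis k (c3 x).
Proof.
move=> Zx; have t0 : t != 0.
  by apply/eqP => t0; have := zorich_neq0 x; rewrite Zx t0 eqxx.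
exists (beam_of x); have := branch_zorich x; rewrite Zx branch_axis// => xE.
have h : c3 x = ln (`|t| / c) by rewrite -{1}xE.
by rewrite h.
Qed.

Local Notation I := (escaping_set Z).

Lemma escaping_zorich x : I (Z x) <-> I x.
Proof.
rewrite /escaping_set /=.
have -> : (fun n => norm3 (iter n Z (Z x))) = [sequence norm3 (iter n.+1 Z x)]_n.
  by apply/funext => n; rewrite -iterSr.
by rewrite (cvg_shiftS (fun n => norm3 (iter n Z x))).
Qed.

Lemma escaping_iter n x : I (iter n Z x) <-> I x.
Proof. by elim: n => [//|n IH]; rewrite iterS escaping_zorich. Qed.

(** The action of [Z] on the x3-axis; also [norm3 (Z x)] is [E (c3 x)] for every [x]. *)
Definition E (t : R) : R := c * expR t.

Lemma E_gt0 t : 0 < E t.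
Proof. by rewrite mulr_gt0 ?c_gt0 ?expR_gt0. Qed.

Lemma E_gt1D t : 0 <= t -> 1 + t <= E t.
Proof.
move=> t0; apply: le_trans (expR_ge1Dx t) _.
by rewrite ler_peMl ?expR_ge0// ltW.
Qed.

Lemma E_lt s t : s < t -> E s < E t.
Proof. by move=> st; rewrite ltr_pM2l ?c_gt0// ltr_expR. Qed.

Lemma E_le s t : s <= t -> E s <= E t.
Proof. by move=> st; rewrite ler_pM2l ?c_gt0// ler_expR. Qed.

(** One step makes any height positive, and each further step adds at least 1 because [c > 1]. The
    bound is uniform in [t]. *)
Lemma iter_E_ge n t : n%:R <= iter n.+1 E t.
Proof.
elim: n => [|n IH]; first by rewrite ltW ?E_gt0.
rewrite iterS; apply: le_trans (E_gt1D _ (le_trans (ler0n _ n) IH)).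
by rewrite -natr1 addrC lerD2l.
Qed.

Lemma iter_zorich_axis0 n t : iter n Z (axis (0, 0) t) = axis (0, 0) (iter n E t).
Proof.
elim: n => // n IH; rewrite !iterS IH zorich_axis beam_sg0 mul1r.
by rewrite axis0E.
Qed.

Lemma norm3_axis0 t : norm3 (axis (0, 0) t) = `|t|.
Proof.
rewrite axis0E; apply: norm3_eq => //.
by rewrite /c1/c2/c3/= expr0n /= !add0r real_normK ?num_real.
Qed.

Lemma escaping_axis0 t : I (axis (0, 0) t).
Proof.
rewrite -escaping_zorich /escaping_set /=.
apply: ger_cvgy (@cvgr_idn R); apply: nearW => n.
rewrite -iterSr iter_zorich_axis0 norm3_axis0.
exact: le_trans (iter_E_ge n t) (ler_norm _).
Qed.

Lemma escaping_axis k t : I (axis k t).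
Proof.
rewrite -escaping_zorich zorich_axis -axis0E; exact: escaping_axis0.
Qed.

(** The norm of an iterate is [E] of the height of the previous one, so large norms force large
    positive heights one step earlier. *)
Lemma escaping_height x (A : R) : I x ->
  exists N, forall n, (N <= n)%N -> A <= c3 (iter n Z x).
Proof.
rewrite -escaping_zorich => /cvgryPge/(_ (c * expR A))[N _ hN].
exists N => n Nn; have := hN n Nn; rewrite -iterSr iterS norm3_zorich.
by rewrite ler_pM2l ?c_gt0// ler_expR.
Qed.

Lemma branch_cont k y : y != 0 -> cont_at (branch k) y.
Proof.
move=> y0 e e0; have n0 : 0 < norm3 y by rewrite norm3_gt0.
have K6 := lipK_ge6; have K0 : 0 < lipK by lra.
exists (Num.min (norm3 y / 4) (e * norm3 y / lipK)).
  by rewrite lt_min !divr_gt0// mulr_gt0.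
move=> y'; rewrite lt_min => /andP[/ltW h1 h2].
apply: le_lt_trans (branch_lip k y y' y0 h1) _.
by rewrite mulrA ltr_pdivrMr// mulrC -ltr_pdivlMr.
Qed.

Lemma c3_branch k y : c3 (branch k y) = ln (norm3 y / c).
Proof. by []. Qed.

Lemma branch_height k y (A : R) : E A < norm3 y -> A < c3 (branch k y).
Proof.
move=> h; rewrite c3_branch -ltr_expR lnK; last first.
  by rewrite posrE divr_gt0 ?c_gt0// (lt_trans (E_gt0 A)).
by rewrite ltr_pdivlMr ?c_gt0// mulrC.
Qed.

Lemma c3_neq0 (y : R3 R) : c3 y != 0 -> y != 0.
Proof. by apply: contra => /eqP ->; rewrite eqxx. Qed.

(** * Inverse branches of iterates *)

(* Far enough from the plane [x3 = 0], a branch of the inverse of an iterate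
   never meets this plane again, so no monodromy occurs. *)
Lemma deep_branch n : exists2 M : R, 0 <= M & forall sgm : R, sgm = 1 \/ sgm = -1 ->
  forall b, M < sgm * c3 (iter n Z b) ->
  exists2 G : R3 R -> R3 R, G (iter n Z b) = b &
    forall y, M < sgm * c3 y -> iter n Z (G y) = y /\ cont_at G y.
Proof.
elim: n => [|n [M M0 IH]].
  exists 0 => // sgm _ b _; exists id => // y _; split => // e e0.
  by exists e.
exists (E M) => [|sgm hsgm b]; first by rewrite ltW ?E_gt0.
rewrite iterS; set x := iter n Z b; set k := beam_of x => hb.
have EM := E_gt0 M; have := zorich_side x; rewrite -/k => side.
have sgmk : sgm = beam_sg k.
  by case: hsgm (beam_sgP k) hb side => -> [] ->; rewrite ?mul1r ?mulN1r//; lra.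
have high y : E M < sgm * c3 y -> y != 0 /\ M < 1 * c3 (branch k y).
  move=> hy; have h1 : E M < `|c3 y|.
    by case: hsgm hy => -> h; apply: lt_le_trans h _; rewrite ?mul1r ?mulN1r ?ler_norm// -normrN ler_norm.
  split; first by rewrite c3_neq0// -normr_gt0 (lt_trans EM).
  rewrite mul1r; apply: branch_height; apply: lt_le_trans h1 _.
  exact: le_trans (c3_le_norm _ _) (norm_le_norm3 _ _).
have [_] := high _ hb; rewrite branch_zorich => hx.
(* A branch sends points far from the plane, on either side, to large positive heights; from here on
   the sign is 1. *)
have [G Gx hG] := IH 1 (or_introl erefl) b hx.
exists (fun y => G (branch k y)); first by rewrite branch_zorich.
move=> y hy; have [y0 hy'] := high y hy; have [Gy cG] := hG _ hy'.
split; last exact: cont_at_comp (branch_cont _ _ y0) cG.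
by rewrite iterS Gy branchK// -sgmk ltW// (lt_trans EM).
Qed.

(** * Pulling back along the x3-axis *)

Local Notation g0 := (branch (0, 0)).

Lemma branch0_axis t : g0 (0, 0, E t) = (0, 0, t).
Proof.
have Et := E_gt0 t; rewrite branch_axis ?lt0r_neq0// axis0E gtr0_norm//.
by rewrite /E mulrAC divff ?mul1r ?expRK// lt0r_neq0 ?c_gt0.
Qed.

Lemma branch0_lip y t (d : R) : d <= E t / 4 -> `|y - (0, 0, E t)| <= d ->
  `|g0 y - (0, 0, t)| <= lipK * (d / E t) /\ 0 < c3 y.
Proof.
move=> h1 h2; have Et := E_gt0 t; rewrite -{1}branch0_axis.
have y0 : (0, 0, E t) != 0 :> R3 R by rewrite c3_neq0// lt0r_neq0.
have nE : norm3 (0, 0, E t) = E t by rewrite -axis0E norm3_axis0 gtr0_norm.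
have K6 := lipK_ge6.
split; last first.
  have := le_trans (c3_le_norm _ (y - (0, 0, E t))) h2.
  by rewrite -[c3 (_ - _)]/(c3 y - E t) ler_norml => /andP[] *; lra.
apply: (le_trans (branch_lip _ _ _ y0 _)); rewrite nE; first exact: le_trans h2 h1.
by rewrite ler_wpM2l ?ler_wpM2r ?invr_ge0//; lra.
Qed.

Lemma iter_E_le n s t : s <= t -> iter n E s <= iter n E t.
Proof. by elim: n => // n IH st; rewrite !iterS E_le ?IH. Qed.

(** For fixed [n] the Lipschitz constants of the pull-backs are uniform in [v >= - r], since the
    heights involved stay above those of the orbit of [- r]. *)
Lemma track_finite n (r eta : R) : 0 < eta -> exists2 d : R, 0 < d &
  forall (y : R3 R) (v : R), - r <= v -> `|y - (0, 0, iter n E v)| <= d ->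
    `|iter n g0 y - (0, 0, v)| < eta /\
    forall i, (i < n)%N -> 0 < c3 (iter i g0 y).
Proof.
move=> eta0; elim: n => [|n [d d0 IH]].
  exists (eta / 2); first by rewrite divr_gt0.
  by move=> y v _ h; split => //; apply: le_lt_trans h _; lra.
have K6 := lipK_ge6; have K0 : 0 < lipK by lra.
set m := E (iter n E (- r)); have m0 : 0 < m by exact: E_gt0.
exists (Num.min (m / 4) (d * m / lipK)).
  by rewrite lt_min !divr_gt0// mulr_gt0.
move=> y v rv; rewrite iterS => h.
have mE : m <= E (iter n E v) by rewrite E_le ?iter_E_le.
have Ev := E_gt0 (iter n E v).
set d' := Num.min _ _ in h.
have d'1 : d' <= E (iter n E v) / 4.
  by apply: (@le_trans _ _ (m / 4)); [rewrite ge_min lexx|lra].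
have [b1 b2] := branch0_lip y (iter n E v) _ d'1 h.
have {}b1 : `|g0 y - (0, 0, iter n E v)| <= d.
  apply: le_trans b1 _; rewrite mulrA ler_pdivrMr// mulrC -ler_pdivlMr//.
  apply: (@le_trans _ _ (d * m / lipK)); first by rewrite ge_min lexx orbT.
  by rewrite ler_wpM2r ?invr_ge0 ?(ltW K0)// ler_wpM2l// ltW.
have [e1 e2] := IH (g0 y) v rv b1.
rewrite iterSr; split => // -[|i] ni //.
by rewrite iterSr; apply: e2.
Qed.

(** At heights above [2 * lipK] each pull-back halves the distance to the axis. *)
Lemma track_deep J (r d : R) : 0 <= d ->
  (forall n, (J <= n)%N -> 2 * lipK <= iter n E (- r) /\ 4 * d <= iter n E (- r)) ->
  forall m (y : R3 R) (v : R), - r <= v -> `|y - (0, 0, iter (m + J) E v)| <= d ->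
    `|iter m g0 y - (0, 0, iter J E v)| <= d / 2 ^+ m /\
    forall i, (i < m)%N -> 0 < c3 (iter i g0 y).
Proof.
move=> + big m; elim: m d big => [|m IH] d big d0 y v rv.
  by rewrite add0n divr1.
rewrite addSn iterS => h.
have [b1 b2] := big (m.+1 + J)%N (leq_addl _ _).
have Ele := iter_E_le (m.+1 + J) _ _ rv; rewrite addSn iterS in b1 b2 Ele.
rewrite iterS in Ele.
have Ev := E_gt0 (iter (m + J) E v); have K6 := lipK_ge6.
have d4 : d <= E (iter (m + J) E v) / 4 by lra.
have [f1 f2] := branch0_lip y (iter (m + J) E v) _ d4 h.
have {}f1 : `|g0 y - (0, 0, iter (m + J) E v)| <= d / 2.
  apply: le_trans f1 _; rewrite mulrA ler_pdivrMr//.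
  have -> : d / 2 * E (iter (m + J) E v) = E (iter (m + J) E v) / 2 * d by ring.
  by rewrite ler_wpM2r//; lra.
have d20 : 0 <= d / 2 by lra.
have big2 n : (J <= n)%N -> 2 * lipK <= iter n E (- r) /\ 4 * (d / 2) <= iter n E (- r).
  by move=> /big[? ?]; split => //; lra.
have [e1 e2] := IH (d / 2) big2 d20 (g0 y) v rv f1.
rewrite iterSr; split; first by rewrite exprS invfM mulrA.
by move=> [|i] ni //; rewrite iterSr; apply: e2.
Qed.

Lemma track_axis (r eta d : R) : 0 < eta -> 0 <= d -> exists n : nat,
  forall (y : R3 R) (v : R), - r <= v -> `|y - (0, 0, iter n.*2 E v)| <= d ->
    `|iter n.*2 g0 y - (0, 0, v)| < eta /\
    forall i, (i < n.*2)%N -> 0 < c3 (iter i g0 y).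
Proof.
move=> eta0 d0.
(* [iter_E_ge] bounds the n-th iterate below by n - 1 only, hence the shift by 2. *)
pose B := 2 * lipK + 4 * d; pose J := (Num.truncn B).+2.
have big n : (J <= n)%N -> 2 * lipK <= iter n E (- r) /\ 4 * d <= iter n E (- r).
  move=> Jn; have K6 := lipK_ge6.
  have : B <= iter n E (- r).
    rewrite -(prednK (leq_trans _ Jn))//; apply: le_trans (iter_E_ge _ _).
    have /ltW := truncnS_gt B; move/le_trans; apply.
    by rewrite ler_nat -ltnS (leq_trans _ (leqSpred _)).
  by rewrite /B => ?; split; lra.
have [e e0 fin] := track_finite J r eta eta0.
pose m0 := (Num.truncn (d / e)).+1.
have m0P : d <= e * m0%:R.
  by rewrite mulrC -ler_pdivrMr// ltW// truncnS_gt.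
(* All but the last [J] of the [n.*2] steps halve the distance. They number at least [m0], which
   brings it from [d] to at most [e], the tolerance for the last [J] steps. *)
pose n := (m0 + J)%N; exists n => y v rv.
have -> : n.*2 = (J + (n.*2 - J))%N.
  by rewrite subnKC// -addnn (leq_trans (leq_addl m0 J)) ?leq_addr.
set m := (n.*2 - J)%N.
have mm : (m0 <= m)%N.
  rewrite /m leq_subRL; first by rewrite addnC -addnn leq_addr.
  by rewrite -addnn (leq_trans (leq_addl m0 J)) ?leq_addr.
rewrite [X in iter X E v]addnC => h.
have [a1 a2] := track_deep J r d d0 big m y v rv h.
have le1 : d / 2 ^+ m <= e.
  rewrite ler_pdivrMr ?exprn_gt0//; apply: le_trans m0P _.
  rewrite ler_wpM2l ?(ltW e0)// -natrX ler_nat.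
  by apply: leq_trans mm _; apply/ltnW/ltn_expl.
have [f1 f2] := fin _ v rv (le_trans a1 le1).
rewrite iterD; split => // i.
have [im|mi] := ltnP i m; first by move=> _; apply: a2.
by rewrite -{1 2}(subnK mi) ltn_add2r iterD => ?; apply: f2.
Qed.

Lemma iter_branch0K n y : (forall i, (i < n)%N -> 0 < c3 (iter i g0 y)) ->
  iter n Z (iter n g0 y) = y /\ cont_at (iter n g0) y.
Proof.
elim: n y => [|n IH] y h; first by split => // e e0; exists e.
have y3 : 0 < c3 y := h 0%N isT.
have y0 : y != 0 by rewrite c3_neq0// lt0r_neq0.
have [|h1 h2] := IH (g0 y); first by move=> i ni; rewrite -iterSr; apply: h.
rewrite iterS iterSr h1 branchK ?beam_sg0 ?mul1r ?(ltW y3)//; split => //.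
move=> e e0; have [d d0 hd] := cont_at_comp _ _ _ (branch_cont (0, 0) _ y0) h2 e e0.
by exists d => // x' /hd; rewrite !iterSr.
Qed.

(** * Locally constant properties, and the passage between neighbouring axes *)

Definition locally_const_on (D P : R3 R -> Prop) : Prop :=
  forall x, I x -> D x -> exists2 e : R, 0 < e &
    forall x', I x' -> D x' -> `|x' - x| < e -> (P x' <-> P x).

(** The indicator of [P] along the path is continuous and omits the value 1/2. *)
Lemma path_const (D P : R3 R -> Prop) (p : R -> R3 R) (a b : R) : a <= b ->
  (forall t, a <= t <= b -> [/\ I (p t), D (p t) &
     forall e : R, 0 < e -> exists2 d : R, 0 < d &
       forall t', `|t' - t| < d -> `|p t' - p t| < e]) ->
  locally_const_on D P -> (P (p a) <-> P (p b)).
Proof.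
move=> ab cp lcP.
pose f t : R := if `[< P (p t) >] then 1 else 0.
have fE t : f t = 1 <-> P (p t).
  by rewrite /f; case: asboolP => // nP; split => // /esym/eqP; rewrite oner_eq0.
have f01 t : f t = 0 \/ f t = 1 by rewrite /f; case: ifP; [right|left].
have cf t e : a <= t <= b -> 0 < e -> exists2 d, 0 < d &
    forall t', a <= t' <= b -> `|t' - t| < d -> `|f t' - f t| < e.
  move=> tab e0; have [It Dt ct] := cp t tab.
  have [e1 e10 h1] := lcP _ It Dt; have [d d0 h2] := ct e1 e10.
  exists d => // t' /cp[It' Dt' _] tt'.
  have H := h1 _ It' Dt' (h2 _ tt').
  have -> : f t' = f t by rewrite /f; congr (if _ then _ else _); apply/asbool_equiv_eq.
  by rewrite subrr normr0.
have nmid t : f t <> 1 / 2 by case: (f01 t) => ->; lra.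
suff fab : f a = f b by rewrite -!fE fab.
case: (f01 a) (f01 b) => ea [] eb; rewrite ?ea ?eb//; exfalso.
  have [t _ /nmid//] : exists2 t, a <= t <= b & f t = 1 / 2.
  by apply: IVT_eps => //; left; rewrite ea eb; lra.
have [t _ /nmid//] : exists2 t, a <= t <= b & f t = 1 / 2.
by apply: IVT_eps => //; right; rewrite ea eb; lra.
Qed.

Definition wedge (s1 s2 : R) (y : R3 R) : Prop :=
  Num.sg (c1 y - c2 y) = s1 /\ Num.sg (c1 y + c2 y) = s2.

(** [g0] multiplies the two signs by constants of square 1, so it acts on wedges as an involution;
    hence the doubled exponents in [iter_wedge]. *)
Lemma wedge_branch0 (s1 s2 : R) : exists s1' s2' : R, forall y, y != 0 ->
  (wedge s1 s2 y -> wedge s1' s2' (g0 y)) /\ (wedge s1' s2' y -> wedge s1 s2 (g0 y)).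
Proof.
have [e1 e1K h1] := hh_sg_diff; have [e2 e2K h2] := hh_sg_sum.
have l0 := lam_gt0.
have par0 : parity 0 = 1 by rewrite /parity expr0.
have wE y : y != 0 -> Num.sg (c1 (g0 y) - c2 (g0 y)) = e1 * Num.sg (c1 y - c2 y) /\
    Num.sg (c1 (g0 y) + c2 (g0 y)) = e2 * Num.sg (c1 y + c2 y).
  move=> y0; have [Qq hq] := hinvP _ (dir_hemisphere _ y0).
  have n0 : 0 < norm3 y by rewrite norm3_gt0.
  have := h1 _ Qq; have := h2 _ Qq; rewrite hq /dir /c1/c2/= -!/(dir y) -mulrDl -mulrBl.
  rewrite !sgrM (@gtr0_sg _ (norm3 y)^-1) ?invr_gt0// !mulr1 => a2 a1.
  rewrite !mulr0z !mulr0 !add0r par0 !mul1r -mulrBr -mulrDr !sgrM (gtr0_sg l0) !mul1r.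
  by rewrite a1 a2 !mulrA -!expr2 e1K e2K !mul1r.
exists (e1 * s1), (e2 * s2) => y y0; have [w1 w2] := wE y y0.
split=> -[v1 v2]; split; rewrite ?w1 ?w2 ?v1 ?v2//.
  by rewrite mulrA -expr2 e1K mul1r.
by rewrite mulrA -expr2 e2K mul1r.
Qed.

Lemma iter_wedge n (s1 s2 : R) y : (forall i, (i < n.*2)%N -> 0 < c3 (iter i g0 y)) ->
  wedge s1 s2 y -> wedge s1 s2 (iter n.*2 g0 y).
Proof.
have [s1' [s2' H]] := wedge_branch0 s1 s2.
elim: n => [//|n IH] h w; rewrite doubleS !iterS.
have nz i : (i < n.+1.*2)%N -> iter i g0 y != 0.
  by move=> /h hi; rewrite c3_neq0// lt0r_neq0.
apply: (H _ _).2; first by rewrite -iterS nz// doubleS.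
apply: (H _ _).1; first by rewrite nz// doubleS ltnW.
by apply: IH => // i ni; apply: h; rewrite doubleS !ltnS ltnW// ltnW.
Qed.

Definition succ_beam (k k' : int * int) : Prop :=
  k' = (k.1 + 1, k.2) \/ k' = (k.1, k.2 + 1).

Lemma succ_beam_sg k k' : succ_beam k k' -> beam_sg k' = - beam_sg k.
Proof. by case=> ->; rewrite /beam_sg /= parity_succ ?mulNr ?mulrN. Qed.

Lemma sgr_eq1P (p u : R) : p = 1 \/ p = -1 -> Num.sg u = p -> 0 < p * u.
Proof.
have [u0|u0|->] := ltgtP u 0.
- by rewrite (ltr0_sg u0) => _ <-; rewrite mulN1r oppr_gt0.
- by rewrite (gtr0_sg u0) => _ <-; rewrite mul1r.
- by rewrite sgr0 => -[] -> /eqP; rewrite eq_sym ?oppr_eq0 oner_eq0.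
Qed.

(** Equal signs mean that |v| < p u, and this sector meets the boundary of the square only in the
    side u = p. *)
Lemma wedge_side (p u v : R) : p = 1 \/ p = -1 -> `|u| <= 1 -> `|u| = 1 \/ `|v| = 1 ->
  Num.sg (u - v) = p -> Num.sg (u + v) = p -> u = p.
Proof.
move=> hp u1 uv /(sgr_eq1P _ _ hp) h1 /(sgr_eq1P _ _ hp) h2.
have vu : `|v| < p * u by rewrite ltr_norml; case: hp h1 h2 => -> *; apply/andP; split; lra.
have pu : p * u <= `|u| by case: hp => ->; [rewrite mul1r|rewrite mulN1r -normrN]; exact: ler_norm.
have {}uv : `|u| = 1 by case: uv => // v1; lra.
move: u1 vu; case: (ger0P u) uv => _ *; case: hp pu h1 h2 => -> *;
have := normr_ge0 v; lra.
Qed.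

(** The common face corresponds to one side of the square, hence to one sector between its
    diagonals, and [hh] carries this sector into a wedge. Over the part of x3 = 0 in that wedge both
    branches land on the common face. *)
Lemma succ_beam_wedge k k' : succ_beam k k' -> exists s1 s2 : R,
  [/\ s1 = 1 \/ s1 = -1, s2 = 1 \/ s2 = -1 &
    forall y, y != 0 -> c3 y = 0 -> wedge s1 s2 y -> branch k y = branch k' y].
Proof.
have [e1 e1K h1] := hh_sg_diff; have [e2 e2K h2] := hh_sg_sum.
have main (p1 p2 : R) : p1 = 1 \/ p1 = -1 -> p2 = 1 \/ p2 = -1 ->
    exists s1 s2 : R, [/\ s1 = 1 \/ s1 = -1, s2 = 1 \/ s2 = -1 &
    forall y, y != 0 -> c3 y = 0 -> wedge s1 s2 y -> let q := hinv (dir y) in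
      [/\ bdQ R q, Num.sg (q.1 - q.2) = p1 & Num.sg (q.1 + q.2) = p2]].
  move=> hp1 hp2; exists (e1 * p1), (e2 * p2); split.
  - by apply: sqr_eq1P; rewrite exprMn e1K mul1r; case: hp1 => ->; rewrite ?expr1n ?sqrrN ?expr1n.
  - by apply: sqr_eq1P; rewrite exprMn e2K mul1r; case: hp2 => ->; rewrite ?expr1n ?sqrrN ?expr1n.
  move=> y y0 h3 [w1 w2] q.
  have [Qq hq] := hinvP _ (dir_hemisphere _ y0).
  have n0 : 0 < norm3 y by rewrite norm3_gt0.
  have := h1 _ Qq; have := h2 _ Qq; rewrite hq /dir /c1/c2/= -!/(dir y) -mulrDl -mulrBl.
  rewrite !sgrM (@gtr0_sg _ (norm3 y)^-1) ?invr_gt0// !mulr1 -/q => a2 a1.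
  split; first exact: hinv_dir_boundary.
    move: w1; rewrite a1 => /(congr1 (fun z => e1 * z)).
    by rewrite !mulrA -expr2 e1K !mul1r.
  move: w2; rewrite a2 => /(congr1 (fun z => e2 * z)).
  by rewrite !mulrA -expr2 e2K !mul1r.
case=> ->.
  have [s1 [s2 [hs1 hs2 H]]] := main _ _ (parityP k.1) (parityP k.1).
  exists s1, s2; split => // y y0 h3 w; have [[[u1 _] bd] g1 g2] := H y y0 h3 w.
  have u := wedge_side _ _ _ (parityP k.1) u1 bd g1 g2.
  by rewrite /branch /beam_pt (face_coord _ _ u).
(* The common face is now the side q.2 = parity k.2, in whose sector q.1 - q.2 has the opposite
   sign. *)
have hN : - parity k.2 = 1 \/ - parity k.2 = -1.
  by case: (parityP k.2) => ->; rewrite ?opprK; [right|left].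
have [s1 [s2 [hs1 hs2 H]]] := main _ _ hN (parityP k.2).
exists s1, s2; split => // y y0 h3 w; have [[[_ u2] bd] g1 g2] := H y y0 h3 w.
have u : (hinv (dir y)).2 = parity k.2.
  apply: (wedge_side _ _ (hinv (dir y)).1 (parityP k.2) u2); first by case: bd => ?; [right|left].
    by rewrite -opprB sgrN g1 opprK.
  by rewrite addrC.
by rewrite /branch /beam_pt (face_coord _ _ u).
Qed.

(** Inside the wedge of [succ_beam_wedge] this is a continuous inverse of [Z] across the plane: it
    passes from beam [k] to beam [k'] through their common face. *)
Definition glue (k k' : int * int) (y : R3 R) : R3 R :=
  if 0 <= c3 y then branch k y else branch k' y.

Lemma glueP k k' y : beam_sg k = 1 -> beam_sg k' = -1 -> y != 0 ->
  (c3 y = 0 -> branch k y = branch k' y) ->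
  Z (glue k k' y) = y /\ cont_at (glue k k') y.
Proof.
move=> sk sk' y0 yk; split.
  rewrite /glue; case: leP => y3; apply: branchK => //; first by rewrite sk mul1r.
  by rewrite sk' mulN1r oppr_ge0 ltW.
move=> e e0; have [d d0 hd] := branch_cont k y y0 e e0.
have [d' d'0 hd'] := branch_cont k' y y0 e e0.
have c3d (y' : R3 R) : `|c3 y' - c3 y| <= `|y' - y| by exact: (c3_le_norm _ (y' - y)).
have [y3|y3|y3] := ltgtP (c3 y) 0.
- exists (Num.min d' (- c3 y)); first by rewrite lt_min d'0 oppr_gt0.
  move=> y'; rewrite lt_min => /andP[h1 h2].
  have := le_lt_trans (c3d y') h2; rewrite ltr_norml => /andP[_ h3].
  rewrite /glue ifN; last by rewrite -ltNge; lra.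
  by rewrite ifN; [apply: hd'|rewrite -ltNge].
- exists (Num.min d (c3 y)); first by rewrite lt_min d0.
  move=> y'; rewrite lt_min => /andP[h1 h2].
  have := le_lt_trans (c3d y') h2; rewrite ltr_norml => /andP[h3 _].
  rewrite /glue ifT; last by lra.
  by rewrite ifT; [apply: hd|exact: ltW].
exists (Num.min d d'); first by rewrite lt_min d0.
move=> y'; rewrite lt_min => /andP[h1 h2].
rewrite [glue _ _ y]/glue y3 lexx /glue; case: ifP => _; first exact: hd.
by rewrite yk//; apply: hd'.
Qed.

Lemma glue_depth k k' y (A : R) : y != 0 -> norm3 y < E A -> c3 (glue k k' y) < A.
Proof.
rewrite -norm3_gt0 => n0 h.
have -> : c3 (glue k k' y) = ln (norm3 y / c) by rewrite /glue; case: ifP.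
rewrite -ltr_expR lnK ?posrE ?divr_gt0 ?c_gt0//.
by rewrite ltr_pdivrMr ?c_gt0// mulrC.
Qed.

Lemma iter_E_cont n (t e : R) : 0 < e -> exists2 d : R, 0 < d &
  forall t', `|t' - t| < d -> `|iter n E t' - iter n E t| < e.
Proof.
elim: n e => [|n IH] e e0; first by exists e.
have [d1 d10 h1] := expR_cont (iter n E t) (e / c) (divr_gt0 e0 c_gt0).
have [d d0 h] := IH d1 d10; exists d => // t' /h /h1.
by rewrite !iterS -mulrBr normrM (gtr0_norm c_gt0) ltr_pdivlMr ?c_gt0// mulrC.
Qed.

(* The lift through [glue] of the pull-back under [iter n g0] of a vertical
   axis is a curve of escaping points. It joins, deep in the lower half-space,
   points close to two neighbouring axes: the pulled-back axis passes close to
   the segment of the x3-axis between [(0, 0, r)] and [(0, 0, -r)]. *)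
Lemma neighbour_axes k k' (s1 s2 M s : R) (P : R3 R -> Prop) :
  beam_sg k = 1 -> beam_sg k' = -1 -> s1 = 1 \/ s1 = -1 -> s2 = 1 \/ s2 = -1 ->
  (forall y, y != 0 -> c3 y = 0 -> wedge s1 s2 y -> branch k y = branch k' y) ->
  locally_const_on (fun x => c3 x < - M) P -> M < s ->
  (P (axis k (- s)) <-> P (axis k' (- s))).
Proof.
move=> sk sk' hs1 hs2 agree lcP Ms.
have l0 := lam_gt0; have c0 := c_gt0.
(* The norm of [Z] at height [- s]: [glue] sends (0, 0, r) and (0, 0, -r) to the points of the two
   axes at that height. *)
have [r rE] : exists r, r = E (- s) by eexists.
have r0 : 0 < r by rewrite rE E_gt0.
have rM : r < E (- M) by rewrite rE E_lt// ltrN2.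
have lnr : ln (r / c) = - s by rewrite rE /E mulrAC divff ?lt0r_neq0// mul1r expRK.
have top : glue k k' (0, 0, r) = axis k (- s).
  by rewrite /glue ltW// branch_axis ?lt0r_neq0// gtr0_norm// lnr.
have bot : glue k k' (0, 0, - r) = axis k' (- s).
  rewrite /glue ifN; last by rewrite -ltNge /c3 /= oppr_lt0.
  by rewrite branch_axis ?oppr_eq0 ?lt0r_neq0// normrN gtr0_norm// lnr.
have near_ax k0 t (tau : R3 R) : tau != 0 -> c3 tau != 0 -> glue k k' tau = axis k0 t -> t < - M ->
    exists2 d : R, 0 < d & forall y', `|y' - tau| < d -> I (glue k k' y') ->
      c3 (glue k k' y') < - M -> (P (glue k k' y') <-> P (axis k0 t)).
  move=> tau0 tau3 gt tM.
  have [e e0 he] := lcP _ (escaping_axis k0 t) tM.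
  have [|_ cg] := glueP k k' _ sk sk' tau0; first by move=> h; rewrite h eqxx in tau3.
  have [d d0 hd] := cg e e0; exists d => // y' /hd; rewrite gt => h *.
  exact: he.
have sM : - s < - M by rewrite ltrN2.
have [d1 d10 h1] : exists2 d : R, 0 < d & forall y', `|y' - (0, 0, r)| < d -> I (glue k k' y') ->
      c3 (glue k k' y') < - M -> (P (glue k k' y') <-> P (axis k (- s))).
  by apply: near_ax; rewrite ?c3_neq0// lt0r_neq0.
have [d2 d20 h2] : exists2 d : R, 0 < d & forall y', `|y' - (0, 0, - r)| < d -> I (glue k k' y') ->
      c3 (glue k k' y') < - M -> (P (glue k k' y') <-> P (axis k' (- s))).
  by apply: near_ax; rewrite ?c3_neq0// oppr_eq0 lt0r_neq0.
(* [d1] and [d2] serve the two ends of the curve; [r + 2 * eta] bounds [norm3] along it, since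
   [norm3] is 2-Lipschitz for the sup norm, and so keeps its lift below [- M]. *)
have [eta [eta0 etaM eta1 eta2]] : exists eta : R, [/\ 0 < eta, r + 2 * eta <= E (- M), eta <= d1 & eta <= d2].
  exists (Num.min ((E (- M) - r) / 2) (Num.min d1 d2)).
  have h3 : 0 < (E (- M) - r) / 2 by lra.
  rewrite !lt_min h3 d10 d20 !ge_min !lexx !orbT; split => //.
  set u := Num.min _ _; have : u <= (E (- M) - r) / 2 by rewrite ge_min lexx.
  lra.
have [n track] := track_axis r eta (2 * lam) eta0 (ltW (mulr_gt0 (ltr0Sn _ 1) l0)).
(* The axis next to T in the prescribed wedge: c1 - c2 = 2 lam s1 and c1 + c2 = 2 lam s2. *)
pose Y v : R3 R := (lam * (s1 + s2), lam * (s2 - s1), iter n.*2 E v).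
have Yax v : exists k0, Y v = axis k0 (iter n.*2 E v).
  rewrite /Y /axis; case: hs1 hs2 => -> [] ->.
  - by exists (1, 0); congr (_, _, _); rewrite /=; ring.
  - by exists (0, -1); congr (_, _, _); rewrite /=; ring.
  - by exists (0, 1); congr (_, _, _); rewrite /=; ring.
  - by exists (-1, 0); congr (_, _, _); rewrite /=; ring.
have IY v : I (Y v) by have [k0 ->] := Yax v; apply: escaping_axis.
have wY v : wedge s1 s2 (Y v).
  rewrite /wedge /Y /c1 /c2 /=.
  have -> : lam * (s1 + s2) - lam * (s2 - s1) = 2 * lam * s1 by ring.
  have -> : lam * (s1 + s2) + lam * (s2 - s1) = 2 * lam * s2 by ring.
  rewrite !sgrM (gtr0_sg l0) (gtr0_sg (ltr0Sn R 1)) !mul1r.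
  by case: hs1 hs2 => -> [] ->; rewrite ?sgr1 ?sgrN1.
have dY v : `|Y v - (0, 0, iter n.*2 E v)| <= 2 * lam.
  have lamc (u : R) : -2 <= u <= 2 -> `|lam * u - 0| <= 2 * lam.
    rewrite -ler_norml subr0 normrM (gtr0_norm l0) mulrC => hu.
    by rewrite ler_wpM2r// ltW.
  apply: norm_ler.
  - by apply: lamc; case: hs1 hs2 => -> [] ->; lra.
  - by apply: lamc; case: hs1 hs2 => -> [] ->; lra.
  - by rewrite /c3 /= subrr normr0 mulr_ge0// ltW.
pose phi v := iter n.*2 g0 (Y v).
have main v : - r <= v <= r -> [/\ `|phi v - (0, 0, v)| < eta, I (glue k k' (phi v)),
    c3 (glue k k' (phi v)) < - M, cont_at (iter n.*2 g0) (Y v) & cont_at (glue k k') (phi v)].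
  move=> /andP[v1 v2]; have [a1 a2] := track (Y v) v v1 (dY v).
  have [a3 a4] := iter_branch0K _ _ a2.
  have w := iter_wedge n s1 s2 _ a2 (wY v); rewrite -/(phi v) in a1 a3 w.
  (* The wedge excludes the x3-axis, so the curve passes from above to below without meeting 0. *)
  have p0 : phi v != 0.
    apply/eqP => p0; case: w => + _; rewrite p0 /c1 /c2 /= subrr sgr0.
    by case: hs1 => -> /eqP; rewrite eq_sym ?oppr_eq0 oner_eq0.
  have [b1 b2] := glueP k k' _ sk sk' p0 (fun h => agree _ p0 h w).
  split => //.
    by rewrite -escaping_zorich b1 -(escaping_iter n.*2) a3.
  apply: glue_depth p0 _; have := norm3_lip _ (phi v) (0, 0, v).
  rewrite -{1}axis0E norm3_axis0 => h.
  have hv : `|v| <= r by rewrite ler_norml v1.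
  have := ler_norm (norm3 (phi v) - `|v|); lra.
have rr : - r <= r by lra.
have rin : - r <= r <= r by rewrite rr lexx.
have rin' : - r <= - r <= r by rewrite rr lexx.
have pc : P (glue k k' (phi (- r))) <-> P (glue k k' (phi r)).
  apply: (path_const (fun x => c3 x < - M) P (fun v => glue k k' (phi v))) => // v hv.
  have [_ b2 b3 b4 b5] := main v hv; split => // e e0.
  have [d3 d30 h3] := b5 e e0; have [d4 d40 h4] := b4 d3 d30.
  have [d5 d50 h5] := iter_E_cont n.*2 v d4 d40.
  exists d5 => // v' /h5 h6; apply: h3; apply: h4.
  by apply: norm_ltr; rewrite /c1 /c2 /c3 /= ?subrr ?normr0.
have [b1 b2 b3 _ _] := main _ rin; have [b1' b2' b3' _ _] := main _ rin'.
have t1 := h1 _ (lt_le_trans b1 eta1) b2 b3.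
have t2 := h2 _ (lt_le_trans b1' eta2) b2' b3'.
exact: iff_trans (iff_sym t1) (iff_trans (iff_sym pc) t2).
Qed.

Lemma int_chain (Q : int -> Prop) : (forall i, Q i <-> Q (i + 1)) -> forall i, Q i <-> Q 0.
Proof.
move=> QS; case=> n.
  elim: n => // n IH; rewrite -addn1 PoszD.
  exact: iff_trans (iff_sym (QS n)) IH.
elim: n => [|n IH]; first exact: (QS (Negz 0)).
have nE : Negz n.+1 + 1 = Negz n by rewrite NegzE intS opprD addrAC addNr add0r.
have h : Q (Negz n.+1) <-> Q (Negz n) by rewrite -nE; exact: QS.
exact: iff_trans h IH.
Qed.

Lemma deep_axes (M s : R) (P : R3 R -> Prop) :
  locally_const_on (fun x => c3 x < - M) P -> M < s ->
  forall k, P (axis k (- s)) <-> P (axis (0, 0) (- s)).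
Proof.
move=> lcP Ms.
have step k k' : succ_beam k k' -> P (axis k (- s)) <-> P (axis k' (- s)).
  move=> kk'; have [s1 [s2 [h1 h2 h3]]] := succ_beam_wedge _ _ kk'.
  have sg' := succ_beam_sg _ _ kk'.
  (* [neighbour_axes] takes first the beam that is mapped to the upper half-space; neighbours have
     opposite signs, so exactly one order fits. *)
  case: (beam_sgP k) => sk; rewrite sk ?opprK in sg'.
    exact: (neighbour_axes k k' s1 s2 M s).
  apply: iff_sym; apply: (neighbour_axes k' k s1 s2 M s) => //.
  by move=> *; apply/esym; apply: h3.
move=> [i j].
have -> : P (axis (i, j) (- s)) <-> P (axis (0, j) (- s)).
  by apply: (int_chain (fun i => P (axis (i, j) (- s)))) => i'; apply: step; left.
by apply: (int_chain (fun j => P (axis (0, j) (- s)))) => j'; apply: step; right.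
Qed.

(** * Lifting an axis through an iterate *)

Lemma iter_zorich_center (n : nat) : iter n Z 0 = axis (0, 0) (iter n E 0).
Proof. by rewrite -iter_zorich_axis0 axis0E. Qed.

(** By continuity at 0, an orbit that comes too close to 0 at time [i] is at time [n] within less
    than [2 * lam] of the orbit of 0, hence of T, while every other axis is at least [2 * lam] away
    from T. *)
Lemma center_orbit_isolated n : exists2 e : R, 0 < e & forall x k t,
  k != (0, 0) -> iter n Z x = axis k t -> forall i, (i <= n)%N -> e <= norm3 (iter i Z x).
Proof.
have l0 := lam_gt0; have l2 : 0 < 2 * lam by rewrite mulr_gt0.
have [d d0 hd] : exists2 d : R, 0 < d & forall j, (j <= n)%N -> forall y : R3 R,
    `|y| < d -> `|iter j Z y - iter j Z 0| < 2 * lam.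
  elim: n => [|n [d d0 IH]].
    by exists (2 * lam) => // j; rewrite leqn0 => /eqP -> y; rewrite /= subr0.
  have [d' d'0 h] := iter_zorich_cont n.+1 0 _ l2.
  exists (Num.min d d'); first by rewrite lt_min d0.
  move=> j; rewrite leq_eqVlt => /orP[/eqP -> |jn] y; rewrite lt_min => /andP[h1 h2].
    by apply: h; rewrite subr0.
  exact: IH.
exists d => // x k t k0 xk i ni; rewrite leNgt; apply/negP => xi.
have := hd (n - i)%N (leq_subr _ _) _ (le_lt_trans (norm_le_norm3 _ _) xi).
rewrite -iterD subnK// xk iter_zorich_center => h.
have int0 (m : int) : `|2 * lam * m%:~R - 2 * lam * 0%:~R| < 2 * lam -> m = 0.
  rewrite -mulrBr subr0 normrM (gtr0_norm l2) gtr_pMr// -intr_norm ltrz1.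
  by move=> h1; apply/eqP; rewrite -normr_le0 -ltzD1.
move: k0; rewrite [k]surjective_pairing.
rewrite (int0 k.1 (le_lt_trans (c1_le_norm _ _) h)).
by rewrite (int0 k.2 (le_lt_trans (c2_le_norm _ _) h)) eqxx.
Qed.

(** A lower bound [e] on the norms turns the relative estimate of [zorich_open] into a factor
    [3 * lipK / e] per step that does not depend on [x]. *)
Lemma iter_zorich_open_unif n (e : R) : 0 < e ->
  exists2 A : R, 0 <= A & exists2 d : R, 0 < d & forall x,
    (forall i, (i < n)%N -> e <= norm3 (iter i.+1 Z x)) ->
    forall y', `|y' - iter n Z x| < d ->
    exists2 x', iter n Z x' = y' & `|x' - x| <= A * `|y' - iter n Z x|.
Proof.
move=> e0; elim: n => [|n [A A0 [d d0 IH]]].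
  by exists 1 => //; exists 1 => // x _ y' _; exists y' => //; rewrite mul1r.
have K6 := lipK_ge6; pose B := 3 * lipK / e.
have B0 : 0 < B by rewrite divr_gt0//; lra.
exists (A * B); first by rewrite mulr_ge0// ltW.
exists (Num.min (e / 8) (d / B)).
  by rewrite lt_min (divr_gt0 d0 B0) divr_gt0.
move=> x hx y'; rewrite lt_min iterS => /andP[h1 h2].
have ex := hx n (ltnSn n); rewrite iterS in ex.
have n0 : 0 < norm3 (Z (iter n Z x)) by lra.
have [|z' zy' hz] := zorich_open (iter n Z x) y'; first by lra.
have {}hz : `|z' - iter n Z x| <= B * `|y' - Z (iter n Z x)|.
  apply: le_trans hz _; rewrite /B -[leRHS]mulrA [_^-1 * _]mulrC.
  rewrite ler_wpM2l//; first by lra.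
  by rewrite ler_wpM2l// lef_pV2// posrE.
have [||x' xz hx'] := IH x _ z'.
- by move=> i ni; apply: hx; rewrite ltnW.
- by apply: le_lt_trans hz _; rewrite mulrC -ltr_pdivlMr.
exists x'; first by rewrite iterS xz.
by apply: le_trans hx' _; rewrite -mulrA ler_wpM2l.
Qed.

Lemma iter_zorich_open n x (r : R) : 0 < r -> exists2 d : R, 0 < d &
  forall y', `|y' - iter n Z x| < d ->
  exists2 x', iter n Z x' = y' & `|x' - x| < r.
Proof.
elim: n r => [|n IH] r r0; first by exists r => // y' h; exists y'.
have [d d0 h] := IH r r0; have K6 := lipK_ge6.
have K0 : 0 < 3 * lipK by lra.
set m := norm3 (Z (iter n Z x)); have m0 : 0 < m by rewrite norm3_gt0 zorich_neq0.
exists (Num.min (m / 8) (d * m / (3 * lipK))).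
  by rewrite lt_min (divr_gt0 (mulr_gt0 d0 m0) K0) (divr_gt0 m0).
move=> y'; rewrite iterS lt_min => /andP[/ltW h1 h2].
have [z' zy' hz] := zorich_open _ _ h1.
have [|x' xz hx'] := h z'; last by exists x'; rewrite ?iterS ?xz.
by apply: le_lt_trans hz _; rewrite mulrA ltr_pdivrMr// mulrC -ltr_pdivlMr.
Qed.

Lemma bounded_cluster (x : nat -> R3 R) (b : R3 R) (r : R) :
  (forall j, `|x j - b| <= r) ->
  exists p : R3 R, forall N (e : R), 0 < e -> exists2 j, (N <= j)%N & `|x j - p| < e.
Proof.
move=> hx.
have cK : compact (((`[c1 b - r, c1 b + r]%classic `*` `[c2 b - r, c2 b + r]%classic)
    `*` `[c3 b - r, c3 b + r]%classic) : set (R3 R)).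
  by apply: compact_setX; [apply: compact_setX|]; apply: segment_compact.
have xK : ((x @ \oo) (((`[c1 b - r, c1 b + r]%classic `*` `[c2 b - r, c2 b + r]%classic)
    `*` `[c3 b - r, c3 b + r]%classic) : set (R3 R))).
  exists 0%N => // j _; have hj := hx j.
  have := le_trans (c1_le_norm _ _) hj; have := le_trans (c2_le_norm _ _) hj.
  have := le_trans (c3_le_norm _ _) hj.
  rewrite -[c1 (_ - _)]/(c1 (x j) - c1 b) -[c2 (_ - _)]/(c2 (x j) - c2 b).
  rewrite -[c3 (_ - _)]/(c3 (x j) - c3 b) !ler_norml => /andP[? ?] /andP[? ?] /andP[? ?].
  by split; [split|]; rewrite /= in_itv /= -/(c1 (x j)) -/(c2 (x j)) -/(c3 (x j)); apply/andP; split; lra.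
have [p [_ clp]] := cK (x @ \oo) _ xK.
exists p => N e e0.
have nb : nbhs p (ball p e) by apply/nbhs_ballP; exists e.
have xN : (x @ \oo) [set x j | j in [set j | (N <= j)%N]] by exists N => // j Nj; exists j.
have [_ [[j Nj <-]]] := clp _ _ xN nb.
by rewrite -ball_normE /= distrC => h; exists j.
Qed.

(* The set of heights that can be reached is closed by compactness and open to
   the left by the uniform openness of the iterates along the axis. *)
Lemma lift_axis n (P : R3 R -> Prop) b k (t0 t1 : R) :
  locally_const_on (fun _ => True) P -> k != (0, 0) ->
  iter n Z b = axis k t0 -> t1 <= t0 ->
  exists2 b', iter n Z b' = axis k t1 & (P b <-> P b').
Proof.
move=> lcP k0 bt0 t10.
have [e e0 he] := center_orbit_isolated n.
have [A A0 [d d0 hd]] := iter_zorich_open_unif n e e0.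
have axD s t : `|axis k s - axis k t| = `|s - t|.
  apply/eqP; rewrite eq_le; apply/andP; split; last exact: (c3_le_norm _ (axis k s - axis k t)).
  by apply: norm_ler; rewrite /c1 /c2 /c3 /= ?subrr ?normr0.
(* The bound on [|x - b|] keeps the lifts bounded, so that they have a cluster point over the
   infimum. *)
pose S := [set t : R | t1 <= t <= t0 /\ exists x,
  [/\ iter n Z x = axis k t, (P b <-> P x) & `|x - b| <= A * (t0 - t)]].
have S0 : S t0.
  by split; [rewrite t10 lexx|exists b; split; rewrite // !subrr normr0 mulr0].
have lbS : lbound S t1 by move=> t [/andP[]].
have hiS : has_inf S by split; [exists t0|exists t1].
set m := inf S.
have m1 : t1 <= m by apply: lb_le_inf => //; exists t0.
have m0 : m <= t0 by apply: ge_inf => //; exists t1.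
have [x [xm xP xb]] : exists x, [/\ iter n Z x = axis k m, (P b <-> P x) & `|x - b| <= A * (t0 - m)].
  have /choice[f hf] : forall j : nat, exists u : R * R3 R,
      [/\ m <= u.1 < m + j.+1%:R^-1, iter n Z u.2 = axis k u.1, (P b <-> P u.2) & `|u.2 - b| <= A * (t0 - u.1)].
    move=> j; have j0 : 0 < j.+1%:R^-1 :> R by rewrite invr_gt0.
    have [t St tj] := inf_adherent j0 hiS.
    have mt : m <= t by apply: ge_inf => //; exists t1.
    by have [_ [x [h1 h2 h3]]] := St; exists (t, x); split => //=; rewrite mt.
  have [|p hp] := bounded_cluster (fun j => (f j).2) b (A * (t0 - m)).
    move=> j; have [/andP[h1 _] _ _ h3] := hf j; apply: le_trans h3 _.
    by rewrite ler_wpM2l// lerD2l lerN2.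
  have close (r : R) : 0 < r -> exists2 j, j.+1%:R^-1 < r & `|(f j).2 - p| < r.
    move=> r0; have [j Nj hj] := hp (Num.truncn r^-1) r r0; exists j => //.
    rewrite -[r]invrK ltf_pV2 ?posrE ?invr_gt0//.
    by apply: lt_le_trans (truncnS_gt _) _; rewrite ler_nat ltnS.
  have pm : iter n Z p = axis k m.
    apply/eqP; rewrite -subr_eq0 -normr_le0; apply/ler_addgt0Pl => r r0; rewrite addr0.
    have r20 : 0 < r / 2 by rewrite divr_gt0.
    have [d1 d10 h1] := iter_zorich_cont n p _ r20.
    have [|j j1 j2] := close (Num.min d1 (r / 2)); first by rewrite lt_min d10.
    move: j1 j2; rewrite !lt_min => /andP[_ j1] /andP[j2 _].
    have [/andP[h2 h3] h4 _ _] := hf j; have := h1 _ j2; rewrite h4 => h5.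
    have -> : iter n Z p - axis k m = (axis k (f j).1 - axis k m) - (axis k (f j).1 - iter n Z p).
      by rewrite subrBB.
    apply: le_trans (ler_normB _ _) _; rewrite axD ger0_norm ?subr_ge0//.
    have h6 : (f j).1 - m < r / 2 by rewrite ltrBlDl (lt_trans h3)// ltrD2l.
    by rewrite [r]splitr lerD// ltW.
  have Ip : I p by rewrite -(escaping_iter n) pm; apply: escaping_axis.
  exists p; split => //.
    have [e1 e10 h1] := lcP p Ip Logic.I; have [j _ j2] := close e1 e10.
    have [_ h4 h5 _] := hf j; rewrite h5; apply: h1 => //.
    by rewrite -(escaping_iter n) h4; apply: escaping_axis.
  apply/ler_addgt0Pl => r r0; have [j _ j2] := close r r0.
  have [/andP[h1 _] _ _ h3] := hf j.
  have -> : p - b = ((f j).2 - b) - ((f j).2 - p) by rewrite subrBB.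
  apply: le_trans (ler_normB _ _) _; rewrite addrC.
  apply: lerD; first exact: ltW.
  by apply: le_trans h3 _; rewrite ler_wpM2l// lerD2l lerN2.
have [tm|tm] := leP m t1.
  have mt : m = t1 by apply: le_anti; rewrite tm m1.
  by exists x; rewrite -?mt.
exfalso.
have Ix : I x by rewrite -(escaping_iter n) xm; apply: escaping_axis.
have [e1 e10 h1] := lcP x Ix Logic.I.
(* One more lift, lower by [del], contradicts the choice of [m]: [d / 2] stays in the range of
   openness, [m - t1] stays above [t1], and [e1 / (A + 1)] stays where [P] agrees with its value at
   [x]. *)
pose del := Num.min (Num.min (d / 2) (m - t1)) (e1 / (A + 1)).
have A1 : 0 < A + 1 by lra.
have del0 : 0 < del by rewrite !lt_min subr_gt0 tm !divr_gt0.
have [del1 del2 del3] : [/\ del <= d / 2, del <= m - t1 & del * (A + 1) <= e1].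
  by rewrite -ler_pdivlMr// /del !ge_min !lexx !orbT.
have dax : `|axis k (m - del) - axis k m| = del.
  by rewrite axD addrAC subrr add0r normrN gtr0_norm.
have [||x' x'm x'x] := hd x _ (axis k (m - del)).
- by move=> i ni; apply: (he x k m).
- by rewrite xm dax; lra.
rewrite xm dax in x'x.
have : S (m - del).
  split; first by apply/andP; split; lra.
  exists x'; split => //.
    apply: (iff_trans xP); apply: iff_sym; apply: h1 => //.
      by rewrite -(escaping_iter n) x'm; apply: escaping_axis.
    by apply: le_lt_trans x'x _; nra.
  have -> : x' - b = (x' - x) + (x - b) by rewrite addrA subrK.
  by apply: le_trans (ler_normD _ _) _; lra.
by move=> /(ge_inf (ex_intro _ t1 lbS)); rewrite -/m; lra.
Qed.

Lemma preaxis_const (P : R3 R -> Prop) :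
  locally_const_on (fun _ => True) P -> (forall t, P (axis (0, 0) t)) ->
  forall n b t, iter n Z b = axis (0, 0) t -> P b.
Proof.
move=> lcP P0; elim=> [b t /= -> //|n IH b t].
rewrite iterS axis0E => /zorich_preaxis[k bk].
have [k0|k0] := eqVneq k (0, 0); first by apply: (IH b (c3 (iter n Z b))); rewrite -k0.
have [M M0 deep] := deep_branch n.
set t0 := c3 _ in bk; pose t1 := Num.min t0 (- (M + 1)).
have t10 : t1 <= t0 by rewrite ge_min lexx.
have [b' b't bb'] := lift_axis n P b k t0 t1 lcP k0 bk t10.
have t1M : M < - t1 by have : t1 <= - (M + 1) by [rewrite ge_min lexx orbT]; lra.
have [|G Gb hG] := deep (-1) (or_intror erefl) b'; first by rewrite b't mulN1r.
have hG' y : c3 y < - M -> iter n Z (G y) = y /\ cont_at G y.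
  by move=> hy; apply: hG; rewrite mulN1r; lra.
have lcG : locally_const_on (fun x => c3 x < - M) (fun x => P (G x)).
  move=> y Iy yM; have [Gy cG] := hG' y yM.
  have IG y' : I y' -> c3 y' < - M -> I (G y').
    by move=> Iy' /hG'[h _]; rewrite -(escaping_iter n) h.
  have [e e0 he] := lcP (G y) (IG y Iy yM) Logic.I.
  have [d d0 hd] := cG e e0; exists d => // y' Iy' y'M /hd h.
  by apply: he => //; apply: IG.
(* The property [P] composed with [G] takes the same value on both axes at height [t1]; on T the
   point [G] lies in the n-th preimage of T, where the induction hypothesis holds. *)
have := deep_axes M (- t1) _ lcG t1M k; rewrite opprK -b't Gb => h.
apply/bb'/h; apply: (IH _ t1).
by apply: (hG' _ _).1; rewrite /axis /c3 /=; lra.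
Qed.

(** * Density of the preimages of the x3-axis, and conclusion *)

(** With norms at least [6 * lipK] the factor of [zorich_open] is at most 1/2, so each backward step
    halves the distance; [8 * D <= B] keeps all steps within its range. *)
Lemma shadow_orbit (B D : R) : 0 < B -> 0 <= D -> 6 * lipK <= B -> 8 * D <= B ->
  forall m x y', (forall i, (i < m)%N -> B <= norm3 (iter i.+1 Z x)) ->
  `|y' - iter m Z x| <= D -> exists2 x', iter m Z x' = y' & `|x' - x| <= D / 2 ^+ m.
Proof.
move=> B0 + KB + m; elim: m D => [|m IH] D D0 DB x y' hB.
  by move=> h; exists y'; rewrite ?expr0 ?divr1.
rewrite iterS => h; have Bm := hB m (ltnSn m); rewrite iterS in Bm.
have n0 : 0 < norm3 (Z (iter m Z x)) by lra.
have K6 := lipK_ge6.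
have [|z' zy' hz] := zorich_open (iter m Z x) y'; first by lra.
have {}hz : `|z' - iter m Z x| <= D / 2.
  apply: le_trans hz _; rewrite mulrA ler_pdivrMr//.
  apply: (@le_trans _ _ (3 * lipK * D)); first by rewrite ler_wpM2l//; lra.
  have -> : D / 2 * norm3 (Z (iter m Z x)) = norm3 (Z (iter m Z x)) / 2 * D by ring.
  by rewrite ler_wpM2r//; lra.
have D2 : 0 <= D / 2 by lra.
have DB2 : 8 * (D / 2) <= B by lra.
have hB2 i : (i < m)%N -> B <= norm3 (iter i.+1 Z x) by move=> im; apply: hB; rewrite ltnW.
have [x' xz hx] := IH _ D2 DB2 x z' hB2 hz.
by exists x'; [rewrite iterS xz|rewrite exprS invfM mulrA].
Qed.

(** Every point is within [lam], the half-width of a beam, of an axis point at its own height. Such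
    a replacement far along the orbit is pulled back by contraction to time [N], then to time 0 by
    openness. *)
Lemma preaxis_dense x (r : R) : I x -> 0 < r ->
  exists x' n t, iter n Z x' = axis (0, 0) t /\ `|x' - x| < r.
Proof.
move=> Ix r0; have l0 := lam_gt0; have K6 := lipK_ge6.
pose B := 6 * lipK + 8 * lam; have B0 : 0 < B by rewrite /B; lra.
have [N hN] := escaping_height x B Ix.
have [d d0 hd] := iter_zorich_open N x r r0.
(* Enough backward steps to shrink [lam] below [d], as 2^m >= m + 1 > lam / d. *)
pose m := Num.truncn (lam / d).
have md : lam / 2 ^+ m < d.
  rewrite ltr_pdivrMr ?exprn_gt0// mulrC -ltr_pdivrMr//.
  apply: lt_le_trans (truncnS_gt _) _; rewrite -natrX ler_nat.
  exact: ltn_expl.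
set y := iter N Z x; set z := iter m Z y.
have hB i : (i < m)%N -> B <= norm3 (iter i.+1 Z y).
  move=> _; rewrite iterS norm3_zorich /y -iterD.
  have Bc := hN (i + N)%N (leq_addl _ _).
  have := E_gt1D _ (le_trans (ltW B0) Bc); rewrite /E; lra.
have zk : `|axis (beam_of z) (c3 z) - z| <= lam.
  apply: norm_ler; rewrite distrC; [exact: fold_index_itv|exact: fold_index_itv|].
  by rewrite /c3/= subrr normr0 ltW.
have KB : 6 * lipK <= B by rewrite /B; lra.
have lB : 8 * lam <= B by rewrite /B; lra.
have [y' yz hy] := shadow_orbit B lam B0 (ltW l0) KB lB m y _ hB zk.
have [x' xy hx] := hd y' (le_lt_trans hy md).
(* The additional iterate sends the axis reached at time m + N to T. *)
exists x', (m + N).+1, (c3 (Z (axis (beam_of z) (c3 z)))); split => //.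
by rewrite iterS iterD xy yz zorich_axis axis0E.
Qed.

Lemma locally_const_escaping (P : R3 R -> Prop) :
  locally_const_on (fun _ => True) P -> P (axis (0, 0) 0) -> forall x, I x -> P x.
Proof.
move=> lcP P0 x Ix.
have seg s t : s <= t -> P (axis (0, 0) s) <-> P (axis (0, 0) t).
  move=> st; apply: (path_const (fun _ => True) P (axis (0, 0))) => // u _.
  split => //; first exact: escaping_axis.
  move=> e e0; exists e => // u' hu.
  by apply: norm_ltr; rewrite /c1 /c2 /c3 /= ?subrr ?normr0.
have Pt t : P (axis (0, 0) t).
  by have [/seg h|/ltW/seg h] := leP 0 t; apply/h.
have [e e0 he] := lcP x Ix Logic.I.
have [x' [n [t [xt xx']]]] := preaxis_dense x e Ix e0.
have Px' := preaxis_const P lcP Pt n x' t xt.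
apply/(he x') => //; rewrite -(escaping_iter n) xt; exact: escaping_axis.
Qed.

(** Membership in a relatively open and closed part of the escaping set is locally constant, and so
    is its negation; whichever holds at the origin holds on the whole set. *)
Lemma escaping_connected : connected I.
Proof.
move=> B [b Bb] [C oC BC] [C' cC' BC'].
have BI x : B x -> I x by rewrite BC => -[].
have nbhsP (A : set (R3 R)) x : open A -> A x ->
    exists2 e : R, 0 < e & forall x', `|x' - x| < e -> A x'.
  move=> oA Ax; have /nbhs_ballP[e /= e0 h] : nbhs x A by exact: open_nbhs_nbhs.
  by exists e => // x' xx'; apply: h; rewrite -ball_normE /= distrC.
have lcB : locally_const_on (fun _ => True) B.
  move=> x Ix _; have [Bx|nBx] := pselect (B x).
    have Cx : C x by move: Bx; rewrite BC => -[].
    have [e e0 he] := nbhsP C x oC Cx; exists e => // x' Ix' _ /he Cx'.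
    by split => // _; rewrite BC.
  have nCx : (~` C') x by move=> Cx; apply: nBx; rewrite BC'.
  have [e e0 he] := nbhsP _ x (closed_openC cC') nCx; exists e => // x' Ix' _ /he nCx'.
  by split=> // Bx'; exfalso; move: Bx'; rewrite BC' => -[_] /nCx'.
have lcN : locally_const_on (fun _ => True) (fun x => ~ B x).
  move=> x Ix _; have [e e0 he] := lcB x Ix Logic.I; exists e => // x' Ix' _ h.
  by rewrite (he x' Ix' Logic.I h).
apply/seteqP; split=> // x Ix.
have [B0|nB0] := pselect (B (axis (0, 0) 0)); first exact: locally_const_escaping lcB B0 x Ix.
by have := locally_const_escaping _ lcN nB0 b (BI b Bb).
Qed.

End ZorichEscaping.

Theorem theorem1p3 (R : realType) (hh : R2 R -> R3 R) (L lam nu : R) :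
  1 <= L ->
  bilipschitz_on_Q L hh ->
  sense_preserving_Q hh ->
  hh @` Qsq R = hemisphere R ->
  hh @` bdQ R = equator R ->
  (forall t : R, -1 <= t <= 1 -> c1 (hh (t, t)) = c2 (hh (t, t))) ->
  (forall t : R, -1 <= t <= 1 -> c1 (hh (t, - t)) = - c2 (hh (t, - t))) ->
  1 <= lam -> L ^+ 5 < lam ->
  0 < nu -> Num.sqrt (2 * L / lam) < nu ->
  connected (escaping_set (zorich hh lam nu)).
Proof.
move=> L1 bl _ hQ hbd hd ha lam1 _ nu0 nuL.
have l0 : 0 < lam by lra.
(* From nu^2 lam > 2 L >= 2 and lam <= lam^2 it follows that (nu lam)^2 > 1. *)
have c_gt1 : 1 < nu * lam.
  have h0 : 0 <= 2 * L / lam by rewrite divr_ge0//; lra.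
  have : Num.sqrt (2 * L / lam) ^+ 2 < nu ^+ 2 by rewrite ltr_pXn2r ?nnegrE ?sqrtr_ge0 ?ltW.
  rewrite sqr_sqrtr// ltr_pdivrMr// => h.
  rewrite -(@ltr_pXn2r _ 2)// ?nnegrE ?mulr_ge0 ?ltW// expr1n exprMn.
  apply: (@lt_le_trans _ _ (nu ^+ 2 * lam)); first by lra.
  by rewrite ler_wpM2l ?sqr_ge0// expr2 ler_peMl// ltW.
exact: (escaping_connected R hh L lam nu (nu * lam) L1 bl hQ hbd hd ha lam1 c_gt1 erefl).
Qed.
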